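(* Let $\Omega\subset\mathbb{R}^N$ ($N\ge 1$) be a bounded domain with smooth boundary, let $\alpha,\beta>0$, $0<\gamma<1$, and let $\rho\in C^{0,\gamma}(\Omega)$ with $\rho\ge 0$, $\rho\not\equiv 0$. Let $f,g,h,k\in C^{0,\gamma}[0,\infty)$ be nonnegative nondecreasing functions with $g(0)=k(0)=0$ and with $g,k>0$ on $(0,\infty)$. Define $\Phi:[0,1)\to[0,\infty)$ by $$\Phi(t)=\int_0^t\frac{1}{\sqrt{2\int_\tau^1\frac{1}{k(\theta)}\,d\theta}}\,d\tau,\qquad 0\le t<1,$$ set $a=\lim_{t\to 1}\Phi(t)$, and let $\Psi:[0,a)\to[0,1)$ be the inverse of $\Phi$. Assume that $$\int_0^a\frac{t f(mt)}{g(M\Psi(t))}\,dt=+\infty\qquad\text{for all }0<m<1<M.$$ Then the system $$\begin{cases}\Delta u-\alpha u+\dfrac{f(u)}{g(v)}+\rho(x)=0,\quad u>0 & \text{in }\Omega,\\[2mm] \Delta v-\beta v+\dfrac{h(u)}{k(v)}=0,\quad v>0 & \text{in }\Omega,\\[1mm] u=0,\ v=0 & \text{on }\partial\Omega\end{cases}$$ has no classical solutions.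
   Context: A classical solution is a pair $(u,v)$ with $u,v\in C^2(\Omega)\cap C(\overline\Omega)$ satisfying the system pointwise. $C^{0,\gamma}(\Omega)$ denotes functions that are Hölder continuous on $\Omega$ with exponent $\gamma$ (hence extending continuously to $\overline\Omega$); $C^{0,\gamma}[0,\infty)$ denotes functions that are locally Hölder continuous on $[0,\infty)$ with exponent $\gamma$. *)

(* Defs.v *)
From HB Require Import structures.
From mathcomp Require Import all_boot all_order all_algebra.
From mathcomp Require Import all_classical all_reals all_analysis.

Set Implicit Arguments.
Unset Strict Implicit.
Unset Printing Implicit Defensive.

Import Order.TTheory GRing.Theory Num.Theory.
Import numFieldNormedType.Exports.

Local Open Scope classical_set_scope.
Local Open Scope ring_scope.

Definition boundary (T : topologicalType) (A : set T) : set T :=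
  closure A `\` interior A.

(* The iterated partial derivative D_(i_1) (... (D_(i_k) w)) for the list of
   indices s = [:: i_1; ...; i_k]. *)
Definition partials (R : realType) (N : nat) (w : 'rV[R]_N -> R)
    (s : seq 'I_N) : 'rV[R]_N -> R :=
  foldr (fun i z => 'D_(delta_mx 0 i) z) w s.

Definition laplacian (R : realType) (N : nat) (w : 'rV[R]_N -> R)
    (x : 'rV[R]_N) : R :=
  \sum_(i < N) partials w [:: i; i] x.

(* Meant for open A.  The differentiability clause is needed because 'D_v is
   total and takes a default value where the derivative does not exist. *)
Definition Ck (R : realType) (N : nat) (k : nat) (A : set 'rV[R]_N)
    (w : 'rV[R]_N -> R) : Prop :=
  forall s : seq 'I_N, (size s <= k)%N -> forall x, A x ->
    {for x, continuous (partials w s)} /\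
    ((size s < k)%N -> forall i, derivable (partials w s) x (delta_mx 0 i)).

Definition smooth (R : realType) (N : nat) (A : set 'rV[R]_N)
    (w : 'rV[R]_N -> R) : Prop :=
  forall k, Ck k A w.

(* Near each of its boundary points, Omega is the region on one side of the
   graph of a smooth function of all the coordinates but one: the i-th one,
   which is reversed when b is true.  [col' i x] is x with its i-th coordinate
   removed. *)
Definition smooth_boundary (R : realType) (N : nat) (Omega : set 'rV[R]_N) :
    Prop :=
  forall x0, boundary Omega x0 ->
    exists (U : set 'rV[R]_N) (i : 'I_N) (b : bool) (G : 'rV[R]_N.-1 -> R),
      [/\ open U, U x0, smooth setT G &
          Omega `&` U = [set x | U x /\ G (col' i x) < (-1) ^+ b * x ord0 i]].

Definition smooth_bounded_domain (R : realType) (N : nat)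
    (Omega : set 'rV[R]_N) : Prop :=
  [/\ open Omega, connected Omega, Omega !=set0, bounded_set Omega &
      smooth_boundary Omega].

(* The norm of 'rV[R]_N is the sup norm; as it is equivalent to the Euclidean
   norm, only the constant C depends on this choice. *)
Definition holder_on (R : realType) (V : normedModType R) (gamma : R)
    (A : set V) (w : V -> R) : Prop :=
  exists C : R, forall x y, A x -> A y ->
    `|w x - w y| <= C * `|x - y| `^ gamma.

Definition locally_holder_ge0 (R : realType) (gamma : R) (f : R -> R) : Prop :=
  forall b : R, holder_on gamma (`[0, b] : set R^o) f.

(* Nonnegative nondecreasing elements of C^{0,gamma}[0,oo); the values of f at
   negative arguments are irrelevant. *)
Definition nonlinearity (R : realType) (gamma : R) (f : R -> R) : Prop :=
  [/\ locally_holder_ge0 gamma f,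
      (forall t, 0 <= t -> 0 <= f t) &
      (forall s t, 0 <= s -> s <= t -> f s <= f t)].

(* The integral over [tau, 1] is finite for 0 < tau; if it diverges for
   tau = 0, its real value is 0 by convention, which affects only one point of
   the outer integral (where the integrand is then 0, as 0^-1 = 0). *)
Definition Phi (R : realType) (k : R -> R) (t : R) : R :=
  \int[lebesgue_measure]_(tau in `[0, t])
    (Num.sqrt (2 * \int[lebesgue_measure]_(theta in `[tau, 1]) (k theta)^-1))^-1.

Definition Phi_end (R : realType) (k : R -> R) : R :=
  lim (Phi k t @[t --> (1 : R)^'-]).

Definition inverse_of_Phi (R : realType) (k Psi : R -> R) : Prop :=
  (forall t, 0 <= t < 1 -> 0 <= Phi k t < Phi_end k /\ Psi (Phi k t) = t) /\
  (forall s, 0 <= s < Phi_end k -> 0 <= Psi s < 1 /\ Phi k (Psi s) = s).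

Definition classical_solution (R : realType) (N : nat) (Omega : set 'rV[R]_N)
    (alpha beta : R) (rho : 'rV[R]_N -> R) (f g h k : R -> R)
    (u v : 'rV[R]_N -> R) : Prop :=
  [/\ Ck 2 Omega u /\ {within closure Omega, continuous u},
      Ck 2 Omega v /\ {within closure Omega, continuous v},
      (forall x, Omega x ->
         laplacian u x - alpha * u x + f (u x) / g (v x) + rho x = 0 /\
         0 < u x),
      (forall x, Omega x ->
         laplacian v x - beta * v x + h (u x) / k (v x) = 0 /\ 0 < v x) &
      (forall x, boundary Omega x -> u x = 0 /\ v x = 0)].

(* Main.v *)
(* Only the maximum principle in a boundary strip is used.  Near the boundary,
   Omega is described by a C^2 defining function sigma with gradient bounded away
   from 0, glued from the local graphs.  On a strip 0 < sigma < eps, comparison with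
   functions W(sigma) gives u >= m sigma (W exponential) and v <= M Psi(sigma),
   because Psi'' = -1/k(Psi) and Psi' k(Psi) is bounded.  Hence
   Delta u <= alpha u - F(sigma) with F(t) = f(mt)/g(M Psi(t)).  Comparing u with W
   where W'' ~ -F, W <= 0 at sigma = delta and sigma = eps, bounds the integral of
   t F(t) over [delta, eps] uniformly in delta, a contradiction. *)
Require Import Defs.
From mathcomp Require Import all_boot all_order all_algebra.
From mathcomp Require Import all_classical all_reals all_analysis.
From mathcomp Require Import ring lra.

Set Implicit Arguments.
Unset Strict Implicit.
Unset Printing Implicit Defensive.

Import Order.TTheory GRing.Theory Num.Theory.
Import numFieldNormedType.Exports.

Local Open Scope classical_set_scope.
Local Open Scope ring_scope.

(** The Laplacian of W(sigma) is W'' |grad sigma|^2 + W' Delta sigma. As sigma is not the distance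
    to the boundary, |grad sigma| is not 1 and Delta sigma has no sign, only a bound [L]; each
    barrier is shaped by how it absorbs W' Delta sigma. An exponential does so by a rate larger than
    L. For M Psi, the bound Psi' k(Psi) <= Q limits this term to L Q times the size of M Psi'', and
    the normalization |grad sigma|^2 >= 1 + L Q pays for it. For the last barrier, the main part
    solves W'' = L W' - F with W' >= 0 instead of W'' = -F. The other obstacle is that F may fail to
    be integrable at 0. An increasing second primitive of -F of this kind cannot be nonpositive at
    both delta and eps, so a decaying exponential is added, with a coefficient proportional to the
    very increment that has to be bounded. At a fixed level t1 < eps this correction cancels only a
    fraction below 1 of the increment, uniformly in delta, and the boundedness of u controls what is
    left. An integration by parts turns that bound into one for the integral of t F(t). *)

(** * Directional derivatives as one-variable derivatives, and the second-derivative test *)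

Lemma is_derive_lineP {R : realType} {V : normedModType R} (f : V -> R)
    (x v : V) (d : R) :
  is_derive x v f d <-> is_derive (0 : R) 1 (fun h : R => f (h *: v + x)) d.
Proof.
have E : 'D_v f x = 'D_1 (fun h : R => f (h *: v + x)) 0.
  rewrite /derive; set g1 := fun h => h^-1 *: _; set g2 := fun h => h^-1 *: _.
  suff -> : g1 = g2 by [].
  by apply/funext => h; rewrite /g1 /g2 /= addr0 scale0r add0r [_%:A]mulr1.
split=> -[df dfE]; apply: DeriveDef.
- exact: (derivable1P f x v).1.
- by rewrite -E.
- exact: (derivable1P f x v).2.
- by rewrite E.
Qed.

Lemma is_derive_line_at {R : realType} {V : normedModType R} (f : V -> R)
    (x v : V) (h d : R) :
  is_derive (h *: v + x) v f d -> is_derive h 1 (fun s : R => f (s *: v + x)) d.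
Proof.
move=> /is_derive_lineP fd; apply/is_derive_lineP.
suff -> : (fun s : R => f ((s *: 1 + h) *: v + x)) =
          (fun s : R => f (s *: v + (h *: v + x))) by [].
by apply/funext => s /=; rewrite scalerDl addrA [s%:A]mulr1.
Qed.

Lemma is_derive_comp1 {R : realType} {V : normedModType R} (W : R -> R)
    (f : V -> R) (x v : V) (a b : R) :
  is_derive (f x) 1 W a -> is_derive x v f b ->
  is_derive x v (fun y => W (f y)) (a * b).
Proof.
move=> Wa /is_derive_lineP fb; apply/is_derive_lineP.
apply: (@is_derive1_comp R W (fun h : R => f (h *: v + x))).
by rewrite scale0r add0r.
Qed.

Lemma line_continuous {R : realType} {V : normedModType R} (v x : V) :
  continuous (fun h : R => h *: v + x).
Proof.
move=> h; apply: cvgD; last exact: cvg_cst.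
by apply: cvgZr_tmp; exact: cvg_id.
Qed.

(** [F1] is differentiable at 0 only, so no Taylor formula is available. Fermat gives F1 0 = 0; if d
    < 0, then [F1] is negative just to the right of 0, and the mean value theorem yields F t < F
    0. *)
Lemma second_derivative_min {R : realType} (F F1 : R -> R) (d : R) :
  (\forall h \near (0 : R), is_derive (h : R) 1 F (F1 h)) ->
  is_derive (0 : R) 1 F1 d ->
  (\forall h \near (0 : R), F 0 <= F h) -> 0 <= d.
Proof.
move=> dF dF1 minF.
have [e e0 He] : exists2 e : R, 0 < e & forall h, `|h| < e ->
    is_derive (h : R) 1 F (F1 h) /\ F 0 <= F h.
  have /nbhs_ballP[e e0 He] : \forall h \near (0 : R),
      is_derive (h : R) 1 F (F1 h) /\ F 0 <= F h by near=> h; split; near: h.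
  by exists e => // h he; apply: He; rewrite /ball /= sub0r normrN.
have F10 : F1 0 = 0.
  have h1 : is_derive (0 : R) 1 F 0.
    apply: (@derive1_at_min R F (- e) e 0).
    - by lra.
    - by move=> t; rewrite in_itv/= -ltr_norml => /He[[]].
    - by rewrite in_itv/=; apply/andP; split; lra.
    - by move=> t; rewrite in_itv/= -ltr_norml => /He[].
  have [] := He 0 _; first by rewrite normr0.
  by move=> h2 _; rewrite -(@derive_val _ _ _ _ _ _ _ h2) (@derive_val _ _ _ _ _ _ _ h1).
rewrite leNgt; apply/negP => d0.
have : (fun h : R => h^-1 *: (F1 (h *: 1 + 0) - F1 0)) @ 0^' --> d.
  by have [+ <-] := dF1.
move=> /cvgrPdist_lt /(_ (- d)); rewrite oppr_gt0 => /(_ d0).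
move=> [e2 /= e20 He2].
have neg h : 0 < h -> h < e2 -> F1 h < 0.
  move=> h0 he2; have /= := He2 h _ _.
  rewrite /= sub0r normrN gtr0_norm// => /(_ he2); rewrite gt_eqF// => /(_ isT).
  rewrite F10 subr0 addr0 [h%:A]mulr1 [_ *: _]/(_ * _) ltr_norml => /andP[+ _].
  rewrite opprK ltrDl oppr_gt0.
  by rewrite pmulr_rlt0 ?invr_gt0.
pose t := Num.min e e2 / 2.
have m0 : 0 < Num.min e e2 by rewrite lt_min e0 e20.
have t0 : 0 < t by rewrite /t; lra.
have me : Num.min e e2 <= e by rewrite ge_min lexx.
have me2 : Num.min e e2 <= e2 by rewrite ge_min lexx orbT.
have te : t < e by rewrite /t; lra.
have te2 : t < e2 by rewrite /t; lra.
have [||c] := @MVT R F F1 0 t t0.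
- move=> x; rewrite in_itv/= => /andP[x0 xt].
  by have [] := He x; rewrite ?gtr0_norm//; lra.
- apply: derivable_within_continuous => x; rewrite in_itv/= => /andP[x0 xt].
  have [] := He x; first by rewrite ger0_norm//; lra.
  by move=> [].
rewrite in_itv/= => /andP[c0 ct] Ft.
have : F 0 <= F t by have [] := He t; rewrite ?gtr0_norm.
have := neg c c0 _; rewrite -subr_ge0 Ft => /(_ ltac:(lra)) cn.
rewrite subr0 pmulr_lge0//; lra.
Unshelve. all: by end_near. Qed.

Lemma continuous_add {R : realType} (T : topologicalType) (a b : T -> R) :
  continuous a -> continuous b -> continuous (fun x => a x + b x).
Proof. by move=> ca cb x; exact: (cvgD (ca x) (cb x)). Qed.

Lemma continuous_mul {R : realType} (T : topologicalType) (a b : T -> R) :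
  continuous a -> continuous b -> continuous (fun x => a x * b x).
Proof. by move=> ca cb x; exact: (cvgM (ca x) (cb x)). Qed.

(** * Calculus of functions with pure second partial derivatives *)

Section coordinate_calculus.
Context {R : realType} {N : nat}.
Implicit Types (w z : 'rV[R]_N -> R) (g H : 'I_N -> 'rV[R]_N -> R).

(** [g] is the gradient and [H] the diagonal of the Hessian, whose trace is the Laplacian. They are
    explicit data, so that sums, products and compositions come with formulas; their continuity
    later gives bounds by compactness. *)
Definition twice_derivable w g H : Prop :=
  continuous w /\ forall i, [/\ continuous (g i), continuous (H i) &
    forall x, is_derive x (delta_mx 0 i : 'rV[R]_N) w (g i x) /\
              is_derive x (delta_mx 0 i : 'rV[R]_N) (g i) (H i x)].

Lemma twice_derivable_cst (c : R) :
  twice_derivable (fun _ => c) (fun _ _ => 0) (fun _ _ => 0).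
Proof.
split=> [|i]; first exact: cst_continuous.
split; try exact: cst_continuous.
by move=> x; split; exact: is_derive_cst.
Qed.

Lemma twice_derivableD {w1 g1 H1 w2 g2 H2} :
  twice_derivable w1 g1 H1 -> twice_derivable w2 g2 H2 ->
  twice_derivable (fun x => w1 x + w2 x) (fun i x => g1 i x + g2 i x)
    (fun i x => H1 i x + H2 i x).
Proof.
move=> [c1 d1] [c2 d2]; split=> [x|i]; first exact: (cvgD (c1 x) (c2 x)).
have [cg1 cH1 D1] := d1 i; have [cg2 cH2 D2] := d2 i; split=> x.
- exact: (cvgD (cg1 x) (cg2 x)).
- exact: (cvgD (cH1 x) (cH2 x)).
- have [D11 D12] := D1 x; have [D21 D22] := D2 x.
  by split; exact: is_deriveD.
Qed.

Lemma twice_derivableM {w1 g1 H1 w2 g2 H2} :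
  twice_derivable w1 g1 H1 -> twice_derivable w2 g2 H2 ->
  twice_derivable (fun x => w1 x * w2 x)
    (fun i x => w1 x * g2 i x + w2 x * g1 i x)
    (fun i x => w1 x * H2 i x + 2 * (g1 i x * g2 i x) + w2 x * H1 i x).
Proof.
move=> [c1 d1] [c2 d2].
split=> [|i]; first exact: continuous_mul.
have [cg1 cH1 D1] := d1 i; have [cg2 cH2 D2] := d2 i; split=> [||x].
- by apply: continuous_add; apply: continuous_mul.
- apply: continuous_add; last exact: continuous_mul.
  by apply: continuous_add; [exact: continuous_mul|apply: continuous_mul; [exact: cst_continuous|exact: continuous_mul]].
- have [D11 D12] := D1 x; have [D21 D22] := D2 x; split.
    exact: is_deriveM.
  have := is_deriveD (is_deriveM D11 D22) (is_deriveM D21 D12).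
  by move/is_derive_eq; apply; rewrite /GRing.scale /=; ring.
Qed.

Lemma twice_derivable_comp {w g H} (F F1 F2 : R -> R) :
  continuous F -> continuous F1 -> continuous F2 ->
  (forall t : R, is_derive t 1 F (F1 t)) -> (forall t : R, is_derive t 1 F1 (F2 t)) ->
  twice_derivable w g H ->
  twice_derivable (fun x => F (w x)) (fun i x => F1 (w x) * g i x)
    (fun i x => F2 (w x) * g i x ^+ 2 + F1 (w x) * H i x).
Proof.
move=> cF cF1 cF2 dF dF1 [cw d].
have cc (G : R -> R) : continuous G -> continuous (fun x => G (w x)).
  by move=> cG x; apply: continuous_comp; [exact: cw|exact: cG].
split=> [|i]; first exact: cc.
have [cg cH D] := d i; split=> [||x].
- by apply: continuous_mul => //; exact: cc.
- apply: continuous_add; last by apply: continuous_mul => //; exact: cc.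
  by apply: continuous_mul; [exact: cc|exact: continuous_mul].
- have [D1 D2] := D x; split; first exact: is_derive_comp1.
  have := is_deriveM (is_derive_comp1 (dF1 (w x)) D1) D2.
  by move/is_derive_eq; apply; rewrite /GRing.scale /=; ring.
Qed.

Lemma twice_derivable_sum (I : Type) (s : seq I) (w : I -> 'rV[R]_N -> R)
    (g H : I -> 'I_N -> 'rV[R]_N -> R) :
  (forall c, twice_derivable (w c) (g c) (H c)) ->
  twice_derivable (fun x => \sum_(c <- s) w c x)
    (fun i x => \sum_(c <- s) g c i x) (fun i x => \sum_(c <- s) H c i x).
Proof.
move=> d; elim: s => [|c s IH].
  have -> : (fun x => \sum_(c <- [::]) w c x) = (fun=> 0).
    by apply/funext => x; rewrite big_nil.
  have z (a : I -> 'I_N -> 'rV[R]_N -> R) :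
      (fun i x => \sum_(c <- [::]) a c i x) = (fun _ _ => 0).
    by apply/funext => i; apply/funext => x; rewrite big_nil.
  by rewrite !z; exact: twice_derivable_cst.
have -> : (fun x => \sum_(c <- c :: s) w c x) =
    (fun x => w c x + \sum_(c <- s) w c x).
  by apply/funext => x; rewrite big_cons.
have z (a : I -> 'I_N -> 'rV[R]_N -> R) :
    (fun i x => \sum_(c <- c :: s) a c i x) =
    (fun i x => a c i x + \sum_(c <- s) a c i x).
  by apply/funext => i; apply/funext => x; rewrite big_cons.
by rewrite !z; exact: twice_derivableD.
Qed.

(** The version for the solutions, whose derivatives live in [Omega]; continuity up to the boundary
    is carried separately. *)
Definition twice_derivable_on (Omega : set 'rV[R]_N) w g H : Prop :=
  forall x, Omega x -> forall i,
    is_derive x (delta_mx 0 i : 'rV[R]_N) w (g i x) /\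
    is_derive x (delta_mx 0 i : 'rV[R]_N) (g i) (H i x).

Lemma Ck2_twice_derivable_on (Omega : set 'rV[R]_N) w : Ck 2 Omega w ->
  twice_derivable_on Omega w (fun i => partials w [:: i])
    (fun i => partials w [:: i; i]).
Proof.
move=> wC x Ox i; split.
  by have [_ /(_ erefl i) dw] := wC [::] isT x Ox; exact: derivableP.
by have [_ /(_ erefl i) dw] := wC [:: i] isT x Ox; exact: derivableP.
Qed.

Lemma twice_derivable_onN (Omega : set 'rV[R]_N) w g H :
  twice_derivable_on Omega w g H ->
  twice_derivable_on Omega (fun x => - w x) (fun i x => - g i x)
    (fun i x => - H i x).
Proof.
by move=> d x Ox i; have [d1 d2] := d x Ox i; split; exact: is_deriveN.
Qed.

(** By the chain rule the left side is the Laplacian of W(w) at [x]. The one-variable test, applied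
    to the difference along each coordinate line, gives the inequality term by term. *)
Lemma laplacian_at_min (Omega : set 'rV[R]_N) u gu Hu w g H
    (W W1 : R -> R) (W2 : R)
    (x : 'rV[R]_N) :
  open Omega -> Omega x -> twice_derivable_on Omega u gu Hu ->
  twice_derivable w g H ->
  (\forall t \near w x, is_derive (t : R) 1 W (W1 t)) ->
  is_derive (w x) 1 W1 W2 ->
  (\forall y \near x, u x - W (w x) <= u y - W (w y)) ->
  W2 * (\sum_i g i x ^+ 2) + W1 (w x) * (\sum_i H i x) <=
    \sum_i Hu i x.
Proof.
move=> oO Ox uC [cw d] dW dW1 minu.
rewrite !mulr_sumr -big_split/= ler_sum// => i _.
set e : 'rV[R]_N := delta_mx 0 i.
have [cg cH D] := d i.
rewrite -subr_ge0.
have Ex : 0 *: e + x = x by rewrite scale0r add0r.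
have nearline (P : set 'rV[R]_N) : (\forall y \near x, P y) ->
    \forall h \near (0 : R), P (h *: e + x).
  move=> nP; have := @line_continuous R _ e x 0.
  by rewrite /continuous_at /= Ex => /(_ P nP).
pose F := (fun h : R => u (h *: e + x)) \- (fun h : R => W (w (h *: e + x))).
pose F1 := (fun h : R => gu i (h *: e + x)) \-
  ((fun h : R => W1 (w (h *: e + x))) * (fun h : R => g i (h *: e + x))).
apply: (@second_derivative_min R F F1).
- have nO : \forall h \near (0 : R), Omega (h *: e + x).
    by apply: nearline; exact: open_nbhs_nbhs.
  have nW : \forall h \near (0 : R),
      is_derive (w (h *: e + x) : R) 1 W (W1 (w (h *: e + x))).
    apply: (nearline (fun y => is_derive (w y : R) 1 W (W1 (w y)))).
    exact: (cw x _ dW).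
  near=> h; apply: is_deriveB.
    by apply: is_derive_line_at; apply: (uC _ _ i).1; near: h.
  apply: (@is_derive_line_at _ _ (fun y => W (w y))).
  apply: is_derive_comp1; last exact: (D _).1.
  by near: h.
- have du := (uC x Ox i).2.
  have dl (a : 'rV[R]_N -> R) b : is_derive x e a b ->
      is_derive (0 : R) 1 (fun h : R => a (h *: e + x)) b.
    by move/is_derive_lineP.
  have dWw := dl _ _ (is_derive_comp1 dW1 (D x).1).
  have := is_deriveB (dl _ _ du) (is_deriveM dWw (dl _ _ (D x).2)).
  by move/is_derive_eq; apply; rewrite !Ex /GRing.scale /=; ring.
- have := nearline (fun y => u x - W (w x) <= u y - W (w y)) minu.
  by apply: filterS => h; rewrite /F /= !Ex.
Unshelve. all: by end_near. Qed.

End coordinate_calculus.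

(** * The comparison principle in a strip a <= sigma <= b *)

Section strip.
Context {R : realType} {N : nat} (Omega : set 'rV[R]_N).
Hypotheses (Omega_open : open Omega) (Omega_bounded : bounded_set Omega).
Variables (sigma : 'rV[R]_N -> R) (g H : 'I_N -> 'rV[R]_N -> R).
Hypothesis sigmaC2 : twice_derivable sigma g H.
Hypothesis sigma_boundary : forall x, boundary Omega x -> sigma x = 0.

Lemma closure_compact : compact (closure Omega).
Proof.
apply: bounded_closed_compact; last exact: closed_closure.
have [M [Mr MO]] := Omega_bounded.
exists M; split => // e Me x Ox.
have cl := @closed_closed_ball_ R 'rV[R]_N 0 e.
suff : closure Omega `<=` closed_ball_ Num.Def.normr (0 : 'rV[R]_N) e.
  by move=> /(_ x Ox); rewrite /closed_ball_ /= sub0r normrN.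
rewrite [X in _ `<=` X]((closure_id _).1 cl); apply: closure_subset => y Oy.
by rewrite /closed_ball_ /= sub0r normrN; exact: MO.
Qed.

(** A negative minimum of u - W(sigma) over the compact strip avoids both levels, and it lies in
    [Omega] because there sigma > a >= 0 while sigma = 0 on the boundary; [laplacian_at_min] then
    contradicts the strict inequality. That inequality is assumed only where u < W(sigma), which
    lets callers bound terms in u by the barrier. *)
Lemma strip_comparison (u : 'rV[R]_N -> R) gu Hu (W W1 W2 : R -> R) (a b : R) :
  twice_derivable_on Omega u gu Hu -> {within closure Omega, continuous u} -> 0 <= a ->
  (forall t, a <= t <= b -> {for t, continuous W}) ->
  (forall t, a < t < b -> is_derive (t : R) 1 W (W1 t) /\
                          is_derive (t : R) 1 W1 (W2 t)) ->
  (forall x, Omega x -> a < sigma x < b -> u x < W (sigma x) ->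
     \sum_i Hu i x < W2 (sigma x) * (\sum_i g i x ^+ 2) +
                     W1 (sigma x) * (\sum_i H i x)) ->
  (forall x, closure Omega x -> sigma x = a -> W a <= u x) ->
  (forall x, closure Omega x -> sigma x = b -> W b <= u x) ->
  forall x, closure Omega x -> a <= sigma x <= b -> W (sigma x) <= u x.
Proof.
move=> uC uc a0 cW dW lapW Wa Wb x Kx sx.
have [cs _] := sigmaC2.
pose K := closure Omega `&` [set y | a <= sigma y <= b].
have cK : compact K.
  apply: compact_closedI; first exact: closure_compact.
  have -> : [set y | a <= sigma y <= b] = sigma @^-1` `[a, b].
    by apply/seteqP; split=> y /=; rewrite in_itv.
  by apply: closed_comp; [move=> y _; exact: cs|exact: itv_closed].
pose z y := u y - W (sigma y).
have cz : {within K, continuous z}.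
  have c1 : {within K, continuous u}.
    by apply: continuous_subspaceW uc => y [].
  have c2 : {within K, continuous (fun y => W (sigma y))}.
    apply: continuous_in_subspaceT => y; rewrite inE => -[_ /= sy].
    by apply: continuous_comp; [exact: cs|exact: cW].
  by move=> y; exact: (cvgB (c1 y) (c2 y)).
have [|c cK' zmin] := @compact_EVT_min _ R z K _ cK cz; first by exists x.
have {cK'}[Oc /andP[ac cb]] : K c by rewrite inE in cK'.
have zx : z c <= z x by apply: zmin; rewrite inE; split.
suff : 0 <= z c by rewrite /z in zx *; lra.
rewrite leNgt; apply/negP => zc.
have ac' : a < sigma c.
  rewrite lt_neqAle ac andbT; apply/eqP => E.
  by have := Wa c Oc (esym E); rewrite /z -E in zc; lra.
have cb' : sigma c < b.
  rewrite lt_neqAle cb andbT; apply/eqP => E.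
  by have := Wb c Oc E; rewrite /z E in zc; lra.
have Omc : Omega c.
  apply: contrapT => nO; have : boundary Omega c.
    by split => // /interior_subset.
  by move/sigma_boundary; lra.
have nO : \forall y \near c, Omega y by exact: open_nbhs_nbhs.
have na : \forall t \near sigma c, a < t < b.
  have : nbhs (sigma c) [set` `]a, b[%R].
    by apply: open_nbhs_nbhs; split; [exact: itv_open|rewrite /= in_itv/= ac' cb'].
  by apply: filterS => t /=; rewrite in_itv.
have ns : \forall y \near c, a < sigma y < b by exact: (cs c _ na).
have zn : \forall y \near c, u c - W (sigma c) <= u y - W (sigma y).
  near=> y; apply: zmin; rewrite inE; split.
    by apply: subset_closure; near: y.
  by rewrite /= !ltW//; have /andP[] : a < sigma y < b by near: y.
have nd : \forall t \near sigma c, is_derive (t : R) 1 W (W1 t).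
  by apply: filterS na => t /dW[].
have [|_ d2] := dW (sigma c); first by rewrite ac' cb'.
have := laplacian_at_min Omega_open Omc uC sigmaC2 nd d2 zn.
by have := lapW c Omc; rewrite ac' cb' => /(_ isT); rewrite /z in zc; lra.
Unshelve. all: by end_near. Qed.

End strip.

(** * Mean values, primitives from the right, continuity of the nonlinearities *)

Lemma is_derive_continuous {R : realType} (F : R -> R) (x d : R) :
  is_derive x 1 F d -> {for x, continuous F}.
Proof. by move=> [+ _] => /derivable1_diffP /differentiable_continuous. Qed.

Lemma mean_value {R : realType} (F dF : R -> R) (a b : R) : a < b ->
  (forall x, a <= x <= b -> is_derive (x : R) 1 F (dF x)) ->
  exists c, a < c < b /\ F b - F a = dF c * (b - a).
Proof.
move=> ab dFx; have [||c cab Fab] := @MVT R F dF a b ab.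
- by move=> x; rewrite in_itv/= => /andP[ax xb]; apply: dFx; rewrite !ltW.
- apply: derivable_within_continuous => x; rewrite in_itv/= => xab.
  by have [] := dFx x xab.
- by exists c; rewrite in_itv/= in cab.
Qed.

Lemma integrable_itv_continuous {R : realType} (c : R -> R) (a b : R) :
  (forall s, a <= s <= b -> {for s, continuous c}) ->
  lebesgue_measure.-integrable `[a, b] (EFin \o c).
Proof.
move=> cc; apply: continuous_compact_integrable; first exact: segment_compact.
apply: continuous_in_subspaceT => s; rewrite inE /= in_itv/=; exact: cc.
Qed.

(** [c] may fail to be integrable at 0, so [G t] is the integral over [t, m] for a point m on the
    right. Taking m strictly beyond [b] makes the derivative two-sided at t = b. *)
Lemma right_primitive {R : realType} (c : R -> R) (b b' : R) :
  b < b' -> (forall s, 0 < s < b' -> {for s, continuous c}) ->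
  exists G : R -> R, forall t, 0 < t <= b ->
    is_derive (t : R) 1 G (- c t) /\
    \int[lebesgue_measure]_(s in `[t, b]) c s = G t - G b.
Proof.
move=> bb' cc; pose m := (b + b') / 2.
have [bm mb'] : b < m /\ m < b' by rewrite /m; split; lra.
have ic (s e : R) : 0 < s -> e <= m ->
    lebesgue_measure.-integrable `[s, e] (EFin \o c).
  move=> s0 em; apply: integrable_itv_continuous => r /andP[sr re].
  by apply: cc; apply/andP; split; lra.
have split_int (s e r : R) : 0 < s -> s <= r -> r <= e -> e <= m ->
    \int[lebesgue_measure]_(t in `[r, e]) c t =
    \int[lebesgue_measure]_(t in `[s, e]) c t -
    \int[lebesgue_measure]_(t in `[s, r]) c t.
  move=> s0 sr re em; rewrite Rintegral_itvB ?bnd_simp//; last exact: ic.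
  rewrite Rintegral_itv_obnd_cbnd//.
  have I := ic r e (lt_le_trans s0 sr) em.
  by apply: integrableS I => //; apply: subset_itvr; rewrite bnd_simp.
exists (fun t => \int[lebesgue_measure]_(s in `[t, m]) c s) => t /andP[t0 tb].
split.
  (* With a base point s below t, the integral over [x, m] is a constant minus the integral over
     [s, x] for x near t, and the fundamental theorem applies to the latter. *)
  have [s [s0 st]] : exists s : R, 0 < s /\ s < t by exists (t / 2); split; lra.
  have [d1 d2] : derivable (fun x => \int[lebesgue_measure]_(r in `[s, x]) c r) t 1 /\
      derive1 (fun x => \int[lebesgue_measure]_(r in `[s, x]) c r) t = c t.
    apply: (@continuous_FTC1_closed _ c s t m); [lra| |lra|].
      by apply: ic => //; lra.
    by apply: cc; apply/andP; split; lra.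
  have D : is_derive t 1 (fun x => \int[lebesgue_measure]_(r in `[s, x]) c r) (c t).
    by apply: DeriveDef; rewrite -?derive1E.
  pose C := \int[lebesgue_measure]_(r in `[s, m]) c r.
  have := is_deriveB (is_derive_cst C t 1) D; rewrite sub0r.
  apply: near_eq_is_derive; near=> x.
  rewrite /= (split_int s m x)//; apply: ltW; near: x.
    exact: lt_nbhsr.
  by apply: lt_nbhsl; lra.
have -> : \int[lebesgue_measure]_(s in `[b, m]) c s =
  \int[lebesgue_measure]_(s in `[t, m]) c s -
  \int[lebesgue_measure]_(s in `[t, b]) c s by apply: split_int => //; lra.
by rewrite opprB addrC subrK.
Unshelve. all: by end_near. Qed.

Lemma nonlinearity_continuous {R : realType} (gamma : R) (f : R -> R) (t : R) :
  0 < gamma -> nonlinearity gamma f -> 0 < t -> {for t, continuous f}.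
Proof.
move=> gamma0 [hf _ _] t0.
have [C HC] := hf (t + 1).
(* The Hölder constant [C] may be zero or negative, whereas the radius (e / C')^(1/gamma) needs a
   positive one. *)
pose C' := `|C| + 1.
have C'0 : 0 < C' by rewrite /C'; have := normr_ge0 C; lra.
apply/cvgrPdist_lt => e e0.
pose d := (e / C') `^ gamma^-1.
have d0 : 0 < d by apply: powR_gt0; rewrite divr_gt0.
near=> x.
have xt : `|t - x| < d by near: x; apply/nbhs_ballP; exists d.
have xt1 : `|t - x| < 1 by near: x; apply/nbhs_ballP; exists 1 => //=.
have x0 : 0 < x by near: x; exact: lt_nbhsr.
have lex : x <= t + 1 by move: xt1; rewrite ltr_norml => /andP[]; lra.
have := HC t x; rewrite /= !in_itv/= => /(_ _ _)/le_lt_trans; apply.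
- by apply/andP; split; lra.
- by apply/andP; split; lra.
have h1 : `|t - x| `^ gamma < e / C'.
  have -> : e / C' = d `^ gamma.
    by rewrite -powRrM mulVf ?gt_eqF// powRr1// divr_ge0// ltW.
  by apply: gt0_ltr_powR; rewrite // nnegrE// ltW.
have h2 : C * `|t - x| `^ gamma <= C' * `|t - x| `^ gamma.
  apply: ler_wpM2r; first exact: powR_ge0.
  by rewrite /C'; have := ler_norm C; lra.
apply: (le_lt_trans h2).
by rewrite mulrC -ltr_pdivlMr.
Unshelve. all: by end_near. Qed.

(** * The profile Psi and its differential equation *)

Section Psi.
Context {R : realType} (k Psi : R -> R).
Hypothesis k_cont : forall t, 0 < t -> {for t, continuous k}.
Hypothesis k_gt0 : forall t, 0 < t -> 0 < k t.
Hypothesis k_mono : forall s t, 0 <= s -> s <= t -> k s <= k t.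
Hypothesis Psi_inv : inverse_of_Phi k Psi.

Let Hk (t : R) := \int[lebesgue_measure]_(s in `[t, 1]) (k s)^-1.

Lemma is_derive_Hk (t : R) : 0 < t < 1 -> is_derive t 1 Hk (- (k t)^-1).
Proof.
move=> /andP[t0 t1].
have [|s /andP[s0 _]|G HG] := @right_primitive R (fun s => (k s)^-1) 1 2.
- by lra.
- by apply: cvgV; [rewrite gt_eqF// k_gt0|exact: k_cont].
have [|dG _] := HG t; first by rewrite t0 ltW.
have := is_deriveB dG (is_derive_cst (G 1) t 1); rewrite subr0.
apply: near_eq_is_derive; near=> x.
have [|_ E] := HG x; last by rewrite /Hk E.
by apply/andP; split; [near: x; exact: lt_nbhsr|apply: ltW; near: x; exact: lt_nbhsl].
Unshelve. all: by end_near. Qed.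

(** This one formula yields both the positivity of [Hk] and, as [k] is nondecreasing and 1 - t <= 1,
    the bound Hk t <= 1 / k t. *)
Lemma Hk_mean (t : R) : 0 < t < 1 ->
  exists c, t < c < 1 /\ Hk t = (1 - t) / k c.
Proof.
move=> /andP[t0 t1].
have [|s /andP[s0 _]|G HG] := @right_primitive R (fun s => (k s)^-1) 1 2.
- by lra.
- by apply: cvgV; [rewrite gt_eqF// k_gt0|exact: k_cont].
have [|c [tc1 Gc]] := @mean_value R G (fun s => - (k s)^-1) t 1 t1.
  move=> x /andP[tx x1]; have [] := HG x => //.
  by rewrite x1 andbT (lt_le_trans t0).
exists c; split => //.
have [|_ E] := HG t; first by rewrite t0 ltW.
rewrite /Hk E -opprB Gc; ring.
Qed.

Lemma Hk_gt0 (t : R) : 0 < t < 1 -> 0 < Hk t.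
Proof.
move=> t01; have [c [/andP[tc c1] ->]] := Hk_mean t01.
move/andP: t01 => [t0 t1]; rewrite divr_gt0 ?subr_gt0// k_gt0//.
exact: lt_trans tc.
Qed.

Lemma Hk_le (t : R) : 0 < t < 1 -> Hk t <= (k t)^-1.
Proof.
move=> t01; have [c [/andP[tc c1] ->]] := Hk_mean t01.
move/andP: t01 => [t0 t1].
have kt := k_gt0 t0; have kc := k_gt0 (lt_trans t0 tc).
have h : (k c)^-1 <= (k t)^-1.
  by rewrite lef_pV2 ?posrE//; apply: k_mono; exact: ltW.
apply: (le_trans _ h); rewrite ger_pMl ?invr_gt0//; lra.
Qed.

Let p (t : R) := (Num.sqrt (2 * Hk t))^-1.

Lemma is_derive_sqrt_Hk (t : R) : 0 < t < 1 ->
  is_derive t 1 (fun s => Num.sqrt (2 * Hk s))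
    (- (k t)^-1 / Num.sqrt (2 * Hk t)).
Proof.
move=> t01; have H0 := Hk_gt0 t01.
have H20 : 0 < 2 * Hk t by rewrite mulr_gt0.
have d1 : is_derive t 1 (fun s => 2 * Hk s) (2 * (- (k t)^-1)).
  by have := is_deriveZ 2 (is_derive_Hk t01).
have := @is_derive_comp1 R R Num.sqrt (fun s => 2 * Hk s) t 1 _ _
  (is_derive1_sqrt H20) d1.
move/is_derive_eq; apply.
have : Num.sqrt (2 * Hk t) != 0 by rewrite sqrtr_eq0 -ltNge.
have : k t != 0 by rewrite gt_eqF// k_gt0//; case/andP: t01.
by move=> kn sn; field; apply/andP.
Qed.

Lemma p_continuous (t : R) : 0 < t < 1 -> {for t, continuous p}.
Proof.
move=> t01; apply: cvgV.
  by rewrite sqrtr_eq0 -ltNge mulr_gt0// Hk_gt0.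
exact: is_derive_continuous (is_derive_sqrt_Hk t01).
Qed.

Lemma p_gt0 (t : R) : 0 < t < 1 -> 0 < p t.
Proof. by move=> t01; rewrite invr_gt0 sqrtr_gt0 mulr_gt0// Hk_gt0. Qed.

Lemma Hk_decr (s t : R) : 0 < s -> s <= t -> t < 1 -> Hk t <= Hk s.
Proof.
rewrite le_eqVlt => s0 /predU1P[->//|st] t1.
have [|c [/andP[sc ct] E]] := @mean_value R Hk (fun x => - (k x)^-1) s t st.
  by move=> x /andP[sx xt]; apply: is_derive_Hk; apply/andP; split; lra.
have : 0 < (k c)^-1 by rewrite invr_gt0 k_gt0//; lra.
by move: E => /= E ?; nra.
Qed.

Lemma p_integrable (u : R) : 0 < u < 1 ->
  lebesgue_measure.-integrable `[0, u] (EFin \o p).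
Proof.
move=> /andP[u0 u1]; apply: measurable_bounded_integrable => //.
- by rewrite /= lebesgue_measure_itv/= lte_fin u0 -EFinB ltry.
- apply/measurable_realfun.measurable_fun_itv_obnd_cbndP.
  have mp : measurable_fun `](0 : R), (1 : R)[ p.
    apply: measurable_realfun.open_continuous_measurable_fun; first exact: itv_open.
    by move=> x; rewrite inE /= in_itv/=; exact: p_continuous.
  by apply: measurable_funS mp => //; apply: subset_itvl; rewrite bnd_simp.
(* On ]0, u] the integrand increases, since [Hk] decreases, and is at most [p u]. The term [p 0]
   covers the endpoint, where [Hk] may take its default value. *)
- exists (p 0 + p u); split; first exact: num_real.
  move=> M pM x; rewrite /= in_itv/= => /andP[x0 xu].
  have p0 y : 0 <= p y by rewrite invr_ge0 sqrtr_ge0.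
  rewrite ger0_norm//; apply: le_trans (ltW pM).
  move: x0; rewrite le_eqVlt => /predU1P[<-|x0]; first by rewrite lerDl.
  apply: (@le_trans _ _ (p u)); last by rewrite lerDr.
  have x01 : 0 < x < 1 by apply/andP; split; lra.
  have u01 : 0 < u < 1 by apply/andP.
  rewrite lef_pV2 ?posrE ?sqrtr_gt0 ?mulr_gt0 ?Hk_gt0//.
  by rewrite ler_wsqrtr// ler_wpM2l// Hk_decr.
Qed.

Lemma is_derive_Phi (t : R) : 0 < t < 1 -> is_derive t 1 (Phi k) (p t).
Proof.
move=> t01; case/andP: (t01) => t0 t1.
have [d1 d2] : derivable (Phi k) t 1 /\ derive1 (Phi k) t = p t.
  apply: (@continuous_FTC1_closed R p 0 t ((t + 1) / 2)) => //; first by lra.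
    by apply: p_integrable; apply/andP; split; lra.
  exact: p_continuous.
by apply: DeriveDef; rewrite -?derive1E.
Qed.

Lemma Phi0 : Phi k 0 = 0.
Proof. by rewrite /Phi set_itv1 Rintegral_set1. Qed.

Lemma Phi_le (s t : R) : 0 < s -> s <= t -> t < 1 -> Phi k s <= Phi k t.
Proof.
rewrite le_eqVlt => s0 /predU1P[->//|st] t1.
have [|c [/andP[sc ct] E]] := @mean_value R (Phi k) p s t st.
  by move=> x /andP[sx xt]; apply: is_derive_Phi; apply/andP; split; lra.
have : 0 < p c by apply: p_gt0; apply/andP; split; lra.
by move: E => /= E ?; nra.
Qed.

Lemma Psi0 : Psi 0 = 0.
Proof. by have [/(_ 0)] := Psi_inv; rewrite lexx ltr01 Phi0 => /(_ isT)[]. Qed.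

(** The limit is not computed: [inverse_of_Phi] at t = 1/2 already places [Phi k 2^-1] in [0,
    Phi_end[. *)
Lemma Phi_end_gt0 : 0 < Phi_end k.
Proof.
have [/(_ 2^-1)] := Psi_inv; have -> : 0 <= (2^-1 : R) < 1.
  by apply/andP; split; lra.
by move=> /(_ isT)[/andP[/le_lt_trans h /h]].
Qed.

Lemma Psi_range (s : R) : 0 < s < Phi_end k -> 0 < Psi s < 1.
Proof.
move=> /andP[s0 sa]; have [_ /(_ s)] := Psi_inv; rewrite ltW//= => /(_ sa).
move=> [/andP[P0 ->] E]; rewrite andbT lt_neqAle P0 andbT.
by apply/eqP => P00; rewrite -P00 Phi0 in E; rewrite -E ltxx in s0.
Qed.

Lemma PhiK (s : R) : 0 < s < Phi_end k -> Phi k (Psi s) = s.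
Proof. by move=> /andP[s0 sa]; have [_ /(_ s)] := Psi_inv; rewrite ltW//= => /(_ sa)[]. Qed.

(** Right continuity of Psi at 0, from the monotonicity of Phi: d = Phi(e1), where e1 = min(e, 1/2)
    stays inside the domain of Phi. If Phi(e1) were 0, then Psi 0 would be e1 rather than 0. *)
Lemma Psi_small (e : R) : 0 < e ->
  exists2 d, 0 < d & forall s, 0 <= s < d -> s < Phi_end k -> 0 <= Psi s < e.
Proof.
move=> e0; pose e1 := Num.min e (2^-1).
have e1e : e1 <= e by rewrite /e1 ge_min lexx.
have e1h : e1 <= 2^-1 by rewrite /e1 ge_min lexx orbT.
have e10 : 0 < e1 by rewrite lt_min e0 invr_gt0 ltr0n.
have e11 : e1 < 1 by lra.
exists (Phi k e1).
  have [/(_ e1)] := Psi_inv; rewrite ltW//= => /(_ e11)[/andP[P0 _] E] _.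
  rewrite lt_neqAle P0 andbT; apply/eqP => P00.
  by rewrite -P00 Psi0 in E; lra.
move=> s /andP[s0 sP] sa; have [_ /(_ s)] := Psi_inv; rewrite s0 sa => /(_ isT).
move=> [/andP[P0 P1] E]; rewrite P0/=; apply: lt_le_trans e1e.
rewrite ltNge; apply/negP => e1P.
by have := Phi_le e10 e1P P1; rewrite E; lra.
Qed.

Let D (s : R) := Num.sqrt (2 * Hk (Psi s)).

Lemma is_derive_Psi (s : R) : 0 < s < Phi_end k -> is_derive s 1 Psi (D s).
Proof.
move=> sa; have P01 := Psi_range sa.
have nP : \forall x \near Psi s, 0 < x < 1.
  have : nbhs (Psi s) [set` `]0, 1[%R].
    by apply: open_nbhs_nbhs; split; [exact: itv_open|rewrite /= in_itv].
  by apply: filterS => t /=; rewrite in_itv.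
have := @is_derive_inverse R (Phi k) Psi (p (Psi s)) (Psi s).
rewrite PhiK// /p invrK; apply.
- apply: filterS nP => x /andP[x0 x1]; have [/(_ x)] := Psi_inv.
  by rewrite ltW//= => /(_ x1)[].
- by apply: filterS nP => x /is_derive_Phi /is_derive_continuous.
- exact: is_derive_Phi.
- by rewrite gt_eqF// p_gt0.
Qed.

(** [D] satisfies the first integral D^2 / 2 = Hk(Psi), so the square root produced by
    differentiating [D] cancels against Psi' = D. The integrand of Phi is designed for this. *)
Lemma is_derive_D (s : R) : 0 < s < Phi_end k ->
  is_derive s 1 D (- (k (Psi s))^-1).
Proof.
move=> sa; have P01 := Psi_range sa.
have := is_derive_comp1 (is_derive_sqrt_Hk P01) (is_derive_Psi sa).
move/is_derive_eq; apply; rewrite /D divfK//.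
by rewrite sqrtr_eq0 -ltNge mulr_gt0// Hk_gt0.
Qed.

(** The last bound, which ties Psi' to Psi'', comes from Hk t <= 1 / k t: D^2 k(Psi)^2 = 2 Hk(Psi)
    k(Psi)^2 <= 2 k(Psi) <= 2 k 1. *)
Lemma Psi_profile : exists D : R -> R, forall s, 0 < s < Phi_end k ->
  [/\ 0 < Psi s < 1, is_derive s 1 Psi (D s),
      is_derive s 1 D (- (k (Psi s))^-1), 0 < D s &
      D s * k (Psi s) <= Num.sqrt (2 * k 1)].
Proof.
exists D => s sa; have P01 := Psi_range sa; case/andP: (P01) => P0 P1.
have kP := k_gt0 P0.
split => //; [exact: is_derive_Psi|exact: is_derive_D| |].
  by rewrite sqrtr_gt0 mulr_gt0// Hk_gt0.
have -> : k (Psi s) = Num.sqrt (k (Psi s) ^+ 2) by rewrite sqrtr_sqr gtr0_norm.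
rewrite -sqrtrM; last by rewrite mulr_ge0// ltW// Hk_gt0.
apply: ler_wsqrtr; rewrite -mulrA ler_wpM2l//.
have h1 : Hk (Psi s) * k (Psi s) ^+ 2 <= (k (Psi s))^-1 * k (Psi s) ^+ 2.
  by rewrite ler_wpM2r ?sqr_ge0// Hk_le.
apply: (le_trans h1); rewrite expr2 mulKf ?gt_eqF//.
by apply: k_mono; exact: ltW.
Qed.

End Psi.

(** * Truncated powers, bump functions and graph functions *)

Section truncated_power.
Context {R : realType}.

Let m (t : R) : R := Num.max 0 t.

Lemma pospart_continuous : continuous m.
Proof.
have : continuous (fun s : R => (s + `|s|) / 2).
  apply: continuous_mul; last exact: cst_continuous.
  by apply: continuous_add; [move=> ?; exact: cvg_id|exact: norm_continuous].
suff -> : (fun s : R => (s + `|s|) / 2) = m by [].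
apply/funext => s; rewrite /m; case: (leP 0 s) => s0.
  by rewrite ger0_norm//; lra.
by rewrite ltr0_norm//; lra.
Qed.

Lemma is_derive_truncated_power (n : nat) (t : R) :
  is_derive t 1 (fun s => m s ^+ n.+2) (n.+2%:R * m t ^+ n.+1).
Proof.
case: (ltgtP t 0) => t0.
- have -> : m t = 0 by rewrite /m max_l// ltW.
  rewrite expr0n mulr0; apply: near_eq_is_derive (is_derive_cst 0 t 1).
  near=> s; have : s < 0 by near: s; exact: lt_nbhsl.
  by move=> s0; rewrite /m max_l ?ltW// expr0n.
- have mE : m t = t by rewrite /m max_r// ltW.
  have d : is_derive t 1 (fun s : R => s ^+ n.+2) (n.+2%:R * m t ^+ n.+1).
    apply: DeriveDef; first exact: exprn_derivable.
    by rewrite exp_derive mE [_ *: 1]mulr1.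
  apply: near_eq_is_derive d; near=> s.
  have : 0 < s by near: s; exact: lt_nbhsr.
  by move=> s0; rewrite /m max_r// ltW.
(* At the kink, Carathéodory's criterion applies with slope function m^(n+1), which is continuous
   and vanishes at 0 because the exponent is positive. *)
- rewrite t0; have -> : m 0 = 0 by rewrite /m max_l.
  rewrite expr0n mulr0; apply/is_derive1_caratheodory.
  exists (fun s => m s ^+ n.+1); split.
  + move=> z; rewrite !subr0 [in m 0]/m maxxx expr0n subr0 exprSr.
    rewrite /m; case: (leP 0 z) => z0 //.
    by rewrite !expr0n !mulr0 mul0r.
  + apply: (@continuous_comp _ _ _ m (fun s => s ^+ n.+1)).
      exact: pospart_continuous.
    exact: exprn_continuous.
  + by rewrite /m maxxx expr0n.
Unshelve. all: by end_near. Qed.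

Lemma truncated_power_continuous n : continuous (fun t => m t ^+ n).
Proof.
move=> t; apply: (@continuous_comp _ _ _ m (fun s => s ^+ n)).
  exact: pospart_continuous.
exact: exprn_continuous.
Qed.

End truncated_power.

Section bump.
Context {R : realType} {N : nat}.

Lemma twice_derivable_coord (i : 'I_N) :
  twice_derivable (fun x : 'rV[R]_N => x 0 i) (fun j _ => (i == j)%:R)
    (fun _ _ => 0).
Proof.
split=> [|j]; first exact: coord_continuous.
split; try exact: cst_continuous.
move=> x; split; last exact: is_derive_cst.
apply/is_derive_lineP.
have -> : (fun h : R => (h *: (delta_mx 0 j : 'rV[R]_N) + x) 0 i) =
    (fun h => (i == j)%:R * h + x 0 i).
  by apply/funext => h; rewrite !mxE/= mulrC.
have := is_deriveD (is_deriveZ ((i == j)%:R : R) (is_derive_id (0 : R) 1))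
  (is_derive_cst (x 0 i) (0 : R) 1).
by move/is_derive_eq; apply; rewrite addr0 [_ *: 1]mulr1.
Qed.

Let rho (c : 'rV[R]_N) (r : R) (x : 'rV[R]_N) : R :=
  r ^+ 2 - \sum_i (x 0 i - c 0 i) ^+ 2.

Lemma twice_derivable_rho c r : exists g H, twice_derivable (rho c r) g H.
Proof.
have d1 i := twice_derivableD (twice_derivable_coord i)
  (twice_derivable_cst (- c 0 i)).
have d2 i := twice_derivableM (d1 i) (d1 i).
have d3 := twice_derivable_sum (index_enum 'I_N) d2.
have d4 := twice_derivableD (twice_derivable_cst (r ^+ 2))
  (twice_derivableM (twice_derivable_cst (-1)) d3).
eexists; eexists; move: d4.
set w := (w in twice_derivable w); suff -> : w = rho c r by exact.
apply/funext => x; rewrite /w /rho mulN1r; congr (_ - _).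
Qed.

(** The bump is the cube of the positive part of r^2 - |x - c|^2 with the Euclidean norm; 3 is the
    least exponent for which the second derivatives are continuous. The Euclidean ball where it is
    positive lies in the sup-norm ball of the same radius, hence in [U]. *)
Lemma bump_function (c : 'rV[R]_N) (U : set 'rV[R]_N) : open U -> U c ->
  exists chi g H, [/\ twice_derivable chi g H, forall x, 0 <= chi x,
    0 < chi c & forall x, 0 < chi x -> U x].
Proof.
move=> oU Uc; have : nbhs c U by exact: open_nbhs_nbhs.
move=> /nbhs_ballP[r /= r0 rU].
have [g [H d]] := twice_derivable_rho c r.
exists (fun x => Num.max 0 (rho c r x) ^+ 3).
have := @twice_derivable_comp R N (rho c r) g H (fun t => Num.max 0 t ^+ 3)
  (fun t => 3 * Num.max 0 t ^+ 2) (fun t => 3 * (2 * Num.max 0 t ^+ 1)).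
move=> dchi; eexists; eexists; split.
- apply: dchi => //.
  + exact: truncated_power_continuous.
  + apply: continuous_mul; first exact: cst_continuous.
    exact: truncated_power_continuous.
  + apply: continuous_mul; first exact: cst_continuous.
    apply: continuous_mul; first exact: cst_continuous.
    exact: truncated_power_continuous.
  + by move=> t; exact: (is_derive_truncated_power 1).
  + by move=> t; have := is_deriveZ 3 (is_derive_truncated_power 0 t).
- by move=> x; rewrite exprn_ge0// le_max lexx.
- rewrite exprn_gt0// lt_max /rho big1 ?subr0 ?exprn_gt0 ?orbT//.
  by move=> i _; rewrite subrr expr0n.
- move=> x; have [rx|rx] := ltP 0 (rho c r x); last by rewrite expr0n ltxx.
  move=> _; apply: rU; split => // i j; rewrite (ord1 i) /ball/=.
  rewrite -(@ltr_pXn2r _ 2)// ?nnegrE// ?(ltW r0)// real_normK ?num_real//.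
  apply: (@le_lt_trans _ _ (\sum_i (x 0 i - c 0 i) ^+ 2)); last first.
    by move: rx; rewrite /rho subr_gt0.
  rewrite (bigD1 j)//= -(sqrrN (c 0 j - _)) opprB lerDl.
  by apply: sumr_ge0 => k _; exact: sqr_ge0.
Qed.

Lemma col'_continuous (i : 'I_N) : continuous (fun x : 'rV[R]_N => col' i x).
Proof.
move=> u A /nbhs_ballP[e /= e0 eA].
apply/nbhs_ballP; exists e => //= v [_ uv]; apply: eA; split => // a j.
by apply: (le_lt_trans _ (uv a (lift i j))); rewrite !mxE.
Qed.

Lemma col'_delta (i j : 'I_N) :
  col' i (delta_mx 0 j : 'rV[R]_N) =
  if unlift i j is Some j' then delta_mx 0 j' else 0.
Proof.
apply/rowP => l; rewrite !mxE/=; case: unliftP => [j'|] ->.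
  by rewrite mxE/= (inj_eq lift_inj).
by rewrite mxE eq_sym (negbTE (neq_lift _ _)).
Qed.

(** The graph function does not depend on the i-th coordinate, whence [g i x = 0]; this gives the
    local defining function slope exactly 1 or -1 in that coordinate. *)
Lemma twice_derivable_graph (i : 'I_N) (G : 'rV[R]_N.-1 -> R) : smooth setT G ->
  exists g H, twice_derivable (fun x : 'rV[R]_N => G (col' i x)) g H /\
    forall x, g i x = 0.
Proof.
move=> sG.
have cG (z : 'rV[R]_N.-1 -> R) : continuous z -> continuous (fun x => z (col' i x)).
  by move=> cz x; apply: continuous_comp; [exact: col'_continuous|exact: cz].
have cP (s : seq 'I_N.-1) : continuous (partials G s).
  by move=> x; have [] := sG (size s) s (leqnn _) x I.
have dP (s : seq 'I_N.-1) a x : is_derive (x : 'rV[R]_N.-1) (delta_mx 0 a) (partials G s)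
    (partials G (a :: s) x).
  have [_ /(_ (ltnSn _) a)] := sG (size s).+1 s (leqnSn _) x I.
  exact: derivableP.
pose g (j : 'I_N) (x : 'rV[R]_N) :=
  if unlift i j is Some a then partials G [:: a] (col' i x) else 0.
pose H (j : 'I_N) (x : 'rV[R]_N) :=
  if unlift i j is Some a then partials G [:: a; a] (col' i x) else 0.
exists g, H; split; last by move=> x; rewrite /g unlift_none.
have dcomp (z : 'rV[R]_N.-1 -> R) (j : 'I_N) (x : 'rV[R]_N) (d : R) :
    is_derive (col' i x) (col' i (delta_mx 0 j : 'rV[R]_N)) z d ->
    is_derive x (delta_mx 0 j : 'rV[R]_N) (fun y => z (col' i y)) d.
  move=> /is_derive_lineP zd; apply/is_derive_lineP.
  suff -> : (fun h : R => z (col' i (h *: (delta_mx 0 j : 'rV[R]_N) + x))) =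
    (fun h : R => z (h *: col' i (delta_mx 0 j) + col' i x)) by [].
  by apply/funext => h; congr (z _); apply/rowP => l; rewrite !mxE.
split=> [|j]; first exact: cG (cP [::]).
rewrite /g /H; case E : (unlift i j) => [a|]; split.
- exact: cG (cP [:: a]).
- exact: cG (cP [:: a; a]).
- move=> x; split; apply: dcomp; rewrite col'_delta E.
    exact: (dP [::] a).
  exact: (dP [:: a] a).
- exact: cst_continuous.
- exact: cst_continuous.
- move=> x; split; last exact: is_derive_cst.
  by apply: (dcomp G); rewrite col'_delta E; exact: is_derive0.
Qed.

End bump.

(** * Gluing a defining function from local pieces *)

Section local_pieces.
Context {R : realType} {N : nat} (Omega : set 'rV[R]_N).
Hypothesis Omega_open : open Omega.

Definition points_inward (x : 'rV[R]_N) (i : 'I_N) (b : bool) : Prop :=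
  \forall t \near (0 : R)^'+,
    Omega ((t * (-1) ^+ b) *: (delta_mx 0 i : 'rV[R]_N) + x).

(** One summand of the defining function: harmless everywhere (nonnegative on the closure, zero on
    the boundary), but positive, and sloped at the boundary, only on [O]. The slope is recorded
    along a coordinate direction that enters [Omega], so that it can be compared with the other
    summands. *)
Definition local_piece (O : set 'rV[R]_N) (w : 'rV[R]_N -> R)
    (g H : 'I_N -> 'rV[R]_N -> R) : Prop :=
  [/\ twice_derivable w g H, forall x, closure Omega x -> 0 <= w x,
      forall x, Omega x -> O x -> 0 < w x,
      forall x, boundary Omega x -> w x = 0 &
      forall x, boundary Omega x -> O x ->
        exists i (b : bool), 0 < (-1) ^+ b * g i x /\ points_inward x i b].

Lemma boundaryP (x : 'rV[R]_N) : boundary Omega x <-> closure Omega x /\ ~ Omega x.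
Proof. by rewrite /boundary; have /interior_id -> := Omega_open. Qed.

Lemma pos_open (w : 'rV[R]_N -> R) : continuous w -> open [set x | 0 < w x].
Proof.
move=> cw; have -> : [set x | 0 < w x] = w @^-1` [set t | 0 < t] by [].
by apply: open_comp; [move=> ? _; exact: cw|exact: open_gt].
Qed.

Lemma interior_local_piece (c : 'rV[R]_N) : Omega c ->
  exists O w g H, [/\ open O, O c & local_piece O w g H].
Proof.
move=> Oc; have [w [g [H [d w0 wc wO]]]] := bump_function Omega_open Oc.
exists [set x | 0 < w x], w, g, H; split => //.
  by apply: pos_open; case: d.
have wb x : boundary Omega x -> ~ 0 < w x by move/boundaryP => [_ nO] /wO.
split => //= x bx; last by move/(wb x bx).
by apply/eqP; rewrite eq_le w0 andbT leNgt; apply/negP; exact: wb.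
Qed.

(** The graph gives [s], which is positive exactly on the part of [Omega] in [U]; a bump [w]
    supported in [U] turns it into the global function w s. On the boundary s = 0 wherever w > 0, so
    the derivative of w s along coordinate i is w times the derivative of s, that is, w (-1)^b. *)
Lemma boundary_local_piece (c : 'rV[R]_N) : smooth_boundary Omega ->
  boundary Omega c -> exists O w g H, [/\ open O, O c & local_piece O w g H].
Proof.
move=> /[apply] -[U [i [b [G [oU Uc sG OU]]]]].
have [w [g [H [d w0 wc wU]]]] := bump_function oU Uc.
have [gG [HG [dG gG0]]] := twice_derivable_graph i sG.
pose s (x : 'rV[R]_N) := (-1) ^+ b * x 0 i + -1 * G (col' i x).
have ds := twice_derivableD
  (twice_derivableM (twice_derivable_cst ((-1) ^+ b)) (twice_derivable_coord i))
  (twice_derivableM (twice_derivable_cst (-1)) dG).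
have OUP x : U x -> (Omega x <-> 0 < s x).
  move=> Ux; have -> : (0 < s x) = (G (col' i x) < (-1) ^+ b * x 0 i).
    by rewrite /s mulN1r subr_gt0.
  split=> [Ox|sx].
    by have : (Omega `&` U) x by []; rewrite OU => -[].
  by have : [set x | U x /\ G (col' i x) < (-1) ^+ b * x ord0 i] x by []; rewrite -OU => -[].
have cs : continuous s by case: ds.
have s_ge0 x : closure Omega x -> U x -> 0 <= s x.
  move=> clx Ux; rewrite leNgt; apply/negP => sx.
  have nU : nbhs x U by exact: open_nbhs_nbhs.
  have nS : nbhs x [set y | s y < 0].
    by apply: (cs x [set t | t < 0]); exact: lt_nbhsl.
  have [y [Oy [Uy sy]]] := clx _ (filterI nU nS).
  by have := (OUP y Uy).1 Oy; rewrite /= in sy; lra.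
have s_eq0 x : boundary Omega x -> U x -> s x = 0.
  move=> /boundaryP[clx nOx] Ux; apply/eqP; rewrite eq_le s_ge0// andbT leNgt.
  by apply/negP => /(OUP x Ux).2.
have dws := twice_derivableM d ds.
exists [set x | 0 < w x], (fun x => w x * s x); eexists; eexists; split => //.
  by apply: pos_open; case: d.
split; first exact: dws.
- move=> x clx; have [wx|wx] := ltP 0 (w x).
    by rewrite mulr_ge0 ?s_ge0//; exact: wU.
  by have -> : w x = 0; [apply/eqP; rewrite eq_le wx w0|rewrite mul0r].
- move=> x Ox /= wx; rewrite mulr_gt0//; apply/(OUP x) => //; exact: wU.
- move=> x bx; have [wx|wx] := ltP 0 (w x).
    by rewrite s_eq0 ?mulr0//; exact: wU.
  by have -> : w x = 0; [apply/eqP; rewrite eq_le wx w0|rewrite mul0r].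
- move=> x bx /= wx; have Ux := wU x wx; exists i, b.
  have sx0 := s_eq0 x bx Ux; rewrite /s in sx0; split.
    by rewrite sx0 eqxx gG0 !mulr0 !mul0r !addr0 mulr1 mulrCA -expr2 sqrr_sign mulr1.
  (* Along this ray [col' i] is constant, so [s] grows from 0 at unit rate: its value at [y] is
     t. *)
  rewrite /points_inward; near=> t.
  set y := _ + x.
  have Uy : U y.
    rewrite /y; near: t.
    have c1 := @line_continuous R _ ((-1) ^+ b *: (delta_mx 0 i : 'rV[R]_N)) x 0.
    have : nbhs (0 : R) [set t | U (t *: ((-1) ^+ b *: (delta_mx 0 i : 'rV[R]_N)) + x)].
      apply: c1; rewrite /= scale0r add0r; exact: open_nbhs_nbhs.
    move=> n0; apply: cvg_within.
    by apply: filterS n0 => t /=; rewrite scalerA.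
  apply/(OUP y Uy); rewrite /s /y.
  have -> : col' i ((t * (-1) ^+ b) *: (delta_mx 0 i : 'rV[R]_N) + x) = col' i x.
    by apply/rowP => l; rewrite !mxE/= eq_sym (negbTE (neq_lift _ _)) mulr0 add0r.
  rewrite !mxE !eqxx mulr1 mulrDr mulrCA -expr2 sqrr_sign mulr1 -addrA sx0 addr0.
  by near: t; exact: nbhs_right_gt.
Unshelve. all: by end_near. Qed.

(** Filler for points outside the closure, so that a piece can be chosen at every point. *)
Lemma trivial_local_piece : local_piece set0 (fun=> 0) (fun _ _ => 0) (fun _ _ => 0).
Proof. by split=> //; exact: twice_derivable_cst. Qed.

(** [w] is 0 at [x] and nonnegative along the inward ray, so the right difference quotients are
    nonnegative. The direction may come from another piece. *)
Lemma inward_derivative_ge0 (O : set 'rV[R]_N) w g H x i b :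
  local_piece O w g H -> boundary Omega x -> points_inward x i b ->
  0 <= (-1) ^+ b * g i x.
Proof.
move=> [[_ d] w0 _ wb _] bx inw; have [_ _ /(_ x)[D _]] := d i.
pose F (h : R) := w ((h * (-1) ^+ b) *: (delta_mx 0 i : 'rV[R]_N) + x).
have F0 : F 0 = 0 by rewrite /F mul0r scale0r add0r wb.
have dF : is_derive (0 : R) 1 F ((-1) ^+ b * g i x).
  have d1 : is_derive (0 : R) 1 (fun h : R => h * (-1) ^+ b) ((-1) ^+ b).
    have := is_deriveZ ((-1) ^+ b : R) (is_derive_id (0 : R) 1).
    rewrite [_ *: 1]mulr1; suff -> : (fun h : R => h * (-1) ^+ b) = (-1) ^+ b \*: id by [].
    by apply/funext => h /=; rewrite mulrC.
  have /is_derive_lineP D0 := D.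
  rewrite mulrC.
  apply: (@is_derive_comp1 R R (fun h : R => w (h *: (delta_mx 0 i : 'rV[R]_N) + x))) => //.
  by rewrite mul0r.
rewrite leNgt; apply/negP => neg.
have : (fun h : R => h^-1 *: (F (h *: 1 + 0) - F 0)) @ 0^' --> (-1) ^+ b * g i x.
  by have [+ <-] := dF.
move=> /cvgr_lt /(_ 0 neg) [e /= e0 He].
have : \forall t \near (0 : R)^'+, False.
  near=> t.
  have t0 : 0 < t by near: t; exact: nbhs_right_gt.
  have /= := He t _ _.
  rewrite /= sub0r normrN gtr0_norm// gt_eqF// => /(_ _ isT) h.
  have te : t < e by near: t; exact: nbhs_right_lt.
  have := h te; rewrite F0 subr0 addr0 [t%:A]mulr1 [_ *: _]/(_ * _).
  rewrite pmulr_rlt0 ?invr_gt0// ltNge => /negP; apply; apply: w0.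
  by apply: subset_closure; near: t.
by move=> /(@filter_not_empty _ _ _).
Unshelve. all: by end_near. Qed.

Lemma sum_gt0 (I : eqType) (s : seq I) (a : I -> R) (i : I) :
  (forall j, 0 <= a j) -> i \in s -> 0 < a i -> 0 < \sum_(j <- s) a j.
Proof.
by move=> a0 si ai; rewrite (big_rem i)//= ltr_pwDl// sumr_ge0.
Qed.

(* The local pieces add up because they all increase, weakly, in any direction
   that points into Omega at a boundary point. *)
Lemma defining_function : bounded_set Omega -> smooth_boundary Omega ->
  exists sigma g H, [/\ twice_derivable sigma g H,
    forall x, Omega x -> 0 < sigma x,
    forall x, boundary Omega x -> sigma x = 0 &
    forall x, boundary Omega x -> 0 < \sum_i g i x ^+ 2].
Proof.
move=> bO sO.
have piece (c : 'rV[R]_N) : exists q : set 'rV[R]_N * ('rV[R]_N -> R) *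
    ('I_N -> 'rV[R]_N -> R) * ('I_N -> 'rV[R]_N -> R),
    [/\ open q.1.1.1, closure Omega c -> q.1.1.1 c &
        local_piece q.1.1.1 q.1.1.2 q.1.2 q.2].
  have [cc|nc] := pselect (closure Omega c); last first.
    exists (set0, fun=> 0, fun _ _ => 0, fun _ _ => 0); split => /=.
    - exact: open0.
    - by move=> /nc.
    - exact: trivial_local_piece.
  have [Oc|nO] := pselect (Omega c).
    have [V [w [g [H [oV Vc lp]]]]] := interior_local_piece Oc.
    by exists (V, w, g, H).
  have [|V [w [g [H [oV Vc lp]]]]] := @boundary_local_piece c sO.
    by apply/boundaryP.
  by exists (V, w, g, H).
have [q qP] := choice piece.
have := closure_compact bO; rewrite compact_cover.
move=> /(_ _ (closure Omega) (fun c => (q c).1.1.1)) [||D' _ cov].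
- by move=> c _; have [] := qP c.
- by move=> c cc; exists c => //; have [_ /(_ cc)] := qP c.
pose s : seq 'rV[R]_N := finmap.enum_fset D'.
have cov' x : closure Omega x -> exists2 c, c \in s & (q c).1.1.1 x.
  by move=> /cov [c /= cD qc]; exists c.
have lp c : local_piece (q c).1.1.1 (q c).1.1.2 (q c).1.2 (q c).2 by have [] := qP c.
have dq c : twice_derivable (q c).1.1.2 (q c).1.2 (q c).2 by have [] := lp c.
exists (fun x => \sum_(c <- s) (q c).1.1.2 x).
exists (fun i x => \sum_(c <- s) (q c).1.2 i x).
exists (fun i x => \sum_(c <- s) (q c).2 i x); split.
- exact: twice_derivable_sum.
- move=> x Ox; have clx := subset_closure Ox; have [c cs qc] := cov' x clx.
  apply: (sum_gt0 (i := c)) => // [j|]; first by have [_ + _ _ _] := lp j; exact.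
  by have [_ _ + _ _] := lp c; exact.
- by move=> x bx; rewrite big1// => c _; have [_ _ _ + _] := lp c; exact.
- move=> x bx; have [clx _] := (boundaryP x).1 bx; have [c cs qc] := cov' x clx.
  have [_ _ _ _ /(_ x bx qc)[i [b [gi inw]]]] := lp c.
  apply: (sum_gt0 (i := i)); [by move=> j; exact: sqr_ge0|exact: mem_index_enum|].
  suff h : 0 < (-1) ^+ b * \sum_(c <- s) (q c).1.2 i x.
    by rewrite exprn_even_gt0//=; apply: contraTneq h => ->; rewrite mulr0 ltxx.
  rewrite mulr_sumr; apply: (sum_gt0 (i := c)) => // j.
  exact: (inward_derivative_ge0 (lp j)).
Qed.

End local_pieces.

(** * Bounds by compactness and normalization of the defining function *)

Lemma twice_derivableZ {R : realType} {N : nat} (c : R) (w : 'rV[R]_N -> R)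
    (g H : 'I_N -> 'rV[R]_N -> R) :
  twice_derivable w g H -> twice_derivable (fun x => c * w x)
    (fun i x => c * g i x) (fun i x => c * H i x).
Proof.
move=> d; have := twice_derivableM (twice_derivable_cst c) d.
set g' := (g' in twice_derivable _ g' _); set H' := (H' in twice_derivable _ _ H').
have -> : g' = (fun i x => c * g i x).
  by apply/funext => i; apply/funext => x; rewrite /g' mulr0 addr0.
suff -> : H' = (fun i x => c * H i x) by [].
by apply/funext => i; apply/funext => x; rewrite /H' mul0r !mulr0 !addr0.
Qed.

Lemma compact_bound {R : realType} (T : topologicalType) (K : set T)
    (w : T -> R) : compact K -> {within K, continuous w} ->
  exists2 b, 0 < b & forall x, K x -> w x <= b.
Proof.
move=> cK cw; have [K0|nK] := pselect (K !=set0); last first.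
  by exists 1 => // x Kx; exfalso; apply: nK; exists x.
have [c _ cmax] := compact_EVT_max K0 cK cw.
exists (`|w c| + 1); first by rewrite ltr_wpDl.
move=> x Kx; apply: (@le_trans _ _ (w c)); first by apply: cmax; rewrite inE.
by apply: (le_trans (ler_norm _)); rewrite lerDl.
Qed.

Lemma compact_positive_bound {R : realType} (T : topologicalType) (K : set T)
    (w : T -> R) : compact K -> {within K, continuous w} ->
  (forall x, K x -> 0 < w x) -> exists2 b, 0 < b & forall x, K x -> b <= w x.
Proof.
move=> cK cw w0; have [K0|nK] := pselect (K !=set0); last first.
  by exists 1 => // x Kx; exfalso; apply: nK; exists x.
have [c cc cmin] := compact_EVT_min K0 cK cw.
by exists (w c); [apply: w0; rewrite inE in cc|move=> x Kx; apply: cmin; rewrite inE].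
Qed.

Section normalization.
Context {R : realType} {N : nat} (Omega : set 'rV[R]_N).
Hypotheses (Omega_open : open Omega) (Omega_bounded : bounded_set Omega).
Hypothesis Omega_smooth : smooth_boundary Omega.

(* The condition 1 + L Q <= |grad sigma|^2 is obtained by multiplying sigma by
   a large constant c, as |grad sigma|^2 scales like c^2 and L like c. *)
Lemma normalized_defining_function (Q a : R) : 0 <= Q -> 0 < a ->
  exists sigma g H L K eps, [/\ twice_derivable sigma g H,
    forall x, Omega x -> 0 < sigma x,
    forall x, boundary Omega x -> sigma x = 0,
    [/\ 0 < L, 0 < K, 0 < eps & eps < a] &
    forall x, Omega x -> sigma x <= eps ->
      [/\ 1 + L * Q <= \sum_i g i x ^+ 2, \sum_i g i x ^+ 2 <= K &
          `|\sum_i H i x| <= L]].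
Proof.
move=> Q0 a0.
have [s0 [g0 [H0 [d spos sbd sgrad]]]] :=
  defining_function Omega_open Omega_bounded Omega_smooth.
have [cs dd] := d.
have cK := closure_compact Omega_bounded.
have csum (I : Type) (l : seq I) (z : I -> 'rV[R]_N -> R) :
    (forall i, continuous (z i)) -> continuous (fun x => \sum_(i <- l) z i x).
  move=> cz; elim: l => [|i l IH].
    rewrite (_ : (fun x => _) = fun=> 0); first exact: cst_continuous.
    by apply/funext => x; rewrite big_nil.
  rewrite (_ : (fun x => _) = fun x => z i x + \sum_(j <- l) z j x).
    exact: continuous_add.
  by apply/funext => x; rewrite big_cons.
have cS : continuous (fun x => \sum_i g0 i x ^+ 2).
  by apply: csum => i; have [cg _ _] := dd i; exact: continuous_mul.
have cT : continuous (fun x => \sum_i H0 i x).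
  by apply: csum => i; have [_ cH _] := dd i.
(* |grad s0|^2 + s0 is positive on the whole closure: inside because s0 > 0, on the boundary because
   the gradient is nonzero. Hence |grad s0|^2 >= c / 2 wherever s0 <= c / 2. *)
have [c c0 cle] : exists2 c, 0 < c &
    forall x, closure Omega x -> c <= \sum_i g0 i x ^+ 2 + s0 x.
  apply: (compact_positive_bound (w := fun x => \sum_i g0 i x ^+ 2 + s0 x) cK).
    exact/continuous_subspaceT/continuous_add.
  move=> x clx; have S0 : 0 <= \sum_i g0 i x ^+ 2.
    by apply: sumr_ge0 => i _; exact: sqr_ge0.
  have [Ox|nO] := pselect (Omega x); first by have := spos x Ox; lra.
  have bx : boundary Omega x by apply/boundaryP.
  by have := sgrad x bx; rewrite sbd//; lra.
have [K0 K00 K0le] := compact_bound cK (continuous_subspaceT cS).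
have [L0 L00 L0le] : exists2 b, 0 < b &
    forall x, closure Omega x -> `|\sum_i H0 i x| <= b.
  apply: (compact_bound (w := fun x => `|\sum_i H0 i x|) cK).
  apply: continuous_subspaceT => x.
  by apply: (continuous_comp (cT x)); exact: norm_continuous.
(* The first summand makes l c / 2 >= 1 + L0 Q, the second makes l >= 1; together l^2 c / 2 >= l (1
   + L0 Q) >= 1 + (l L0) Q. *)
pose l := (1 + L0 * Q) * (2 / c) + 1.
have LQ0 : 0 <= L0 * Q by rewrite mulr_ge0// ltW.
have l1 : 1 <= l.
  by rewrite /l lerDr mulr_ge0 ?divr_ge0 ?addr_ge0 ?(ltW c0).
have l0 : 0 < l by apply: lt_le_trans l1.
have key : 1 + (l * L0) * Q <= l ^+ 2 * (c / 2).
  have h1 : 1 + L0 * Q <= l * (c / 2).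
    have -> : l * (c / 2) = 1 + L0 * Q + c / 2.
      by rewrite /l; field; rewrite gt_eqF.
    by rewrite lerDl divr_ge0// ltW.
  have h2 : l * (1 + L0 * Q) <= l * (l * (c / 2)) by rewrite ler_pM2l.
  have -> : l ^+ 2 * (c / 2) = l * (l * (c / 2)) by ring.
  by apply: le_trans h2; nra.
exists (fun x => l * s0 x), (fun i x => l * g0 i x), (fun i x => l * H0 i x).
(* The bound l s0 <= l (c / 2) returns s0 <= c / 2, and a / 2 ensures eps < a. *)
exists (l * L0), (l ^+ 2 * K0), (Num.min (l * (c / 2)) (a / 2)).
have m1 : Num.min (l * (c / 2)) (a / 2) <= l * (c / 2) by rewrite ge_min lexx.
have m2 : Num.min (l * (c / 2)) (a / 2) <= a / 2 by rewrite ge_min lexx orbT.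
split.
- exact: twice_derivableZ.
- by move=> x Ox; rewrite mulr_gt0// spos.
- by move=> x bx; rewrite sbd// mulr0.
- split; rewrite ?mulr_gt0 ?exprn_gt0//; last by lra.
  by rewrite lt_min mulr_gt0 ?divr_gt0.
- move=> x Ox sx; have clx := subset_closure Ox.
  have s0x : s0 x <= c / 2 by rewrite -(ler_pM2l l0); exact: le_trans m1.
  have -> : \sum_i (l * g0 i x) ^+ 2 = l ^+ 2 * \sum_i g0 i x ^+ 2.
    by rewrite mulr_sumr; apply: eq_bigr => i _; rewrite exprMn.
  have -> : \sum_i l * H0 i x = l * \sum_i H0 i x by rewrite mulr_sumr.
  split.
  + apply: (le_trans key); rewrite ler_pM2l ?exprn_gt0//.
    by have := cle x clx; lra.
  + by rewrite ler_pM2l ?exprn_gt0// K0le.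
  + by rewrite normrM gtr0_norm// ler_pM2l// L0le.
Qed.

(** A point of the closure with largest i-th coordinate cannot lie in the open set [Omega]. The
    index [i] is what N >= 1 provides. *)
Lemma boundary_nonempty (i : 'I_N) : Omega !=set0 -> exists x, boundary Omega x.
Proof.
move=> [x0 Ox0].
have [||c cc cmax] := @compact_EVT_max _ R (fun x : 'rV[R]_N => x 0 i) (closure Omega)
    _ (closure_compact Omega_bounded).
- by exists x0; exact: subset_closure.
- by apply: continuous_subspaceT; exact: coord_continuous.
exists c; apply/boundaryP => //; rewrite inE in cc; split => // Oc.
have : \forall h \near (0 : R)^'+, False.
  near=> h.
  have h0 : 0 < h by near: h; exact: nbhs_right_gt.
  have Oh : Omega (h *: (delta_mx 0 i : 'rV[R]_N) + c).
    near: h; have c1 := @line_continuous R _ (delta_mx 0 i : 'rV[R]_N) c 0.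
    apply: cvg_within; apply: (c1 Omega); rewrite scale0r add0r.
    exact: open_nbhs_nbhs.
  have := cmax (h *: (delta_mx 0 i : 'rV[R]_N) + c).
  rewrite inE => /(_ (subset_closure Oh)); rewrite !mxE !eqxx mulr1; lra.
by move=> /(@filter_not_empty _ _ _).
Unshelve. all: by end_near. Qed.

End normalization.

(** * Second primitives, and integrals with a possible singularity at 0 *)

Lemma is_derive_expRM {R : realType} (A t : R) :
  is_derive t 1 (fun s => expR (A * s)) (A * expR (A * t)).
Proof.
have d : is_derive t 1 (fun s : R => A * s) A.
  by have := is_deriveZ A (is_derive_id t 1); rewrite [_ *: 1]mulr1.
have := @is_derive_comp1 R R expR (fun s => A * s) t 1 _ _ (is_derive_expR (A * t)) d.
by rewrite mulrC.
Qed.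

Section primitives.
Context {R : realType} (F : R -> R) (B eps a : R).
Hypotheses (B0 : 0 <= B) (eps0 : 0 < eps) (epsa : eps < a).
Hypothesis F_cont : forall t, 0 < t < a -> {for t, continuous F}.
Hypothesis F_ge0 : forall t, 0 < t < a -> 0 <= F t.

(* P1 solves P1' = B P1 - F with P1 >= 0, and P is a primitive of P1: two
   integrations of F, so that a bound on P near 0 bounds the integral of s F. *)
Lemma iterated_primitive : exists P P1 : R -> R,
  (forall t, 0 < t <= eps -> [/\ is_derive (t : R) 1 P (P1 t),
     is_derive (t : R) 1 P1 (B * P1 t - F t) & 0 <= P1 t]) /\
  (forall C t1, 0 < t1 <= eps -> (forall t, 0 < t < t1 -> - C <= P t) ->
     exists C', forall t, 0 < t <= eps ->
       \int[lebesgue_measure]_(s in `[t, eps]) (s * F s) <= C').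
Proof.
have e0 := eps0; have ea := epsa; pose b1 := (eps + a) / 2.
have [eb ba] : eps < b1 /\ b1 < a by rewrite /b1; split; lra.
have [s /andP[s0 sa]|G1 HG1] := @right_primitive R (fun s => expR (- B * s) * F s) b1 a ba.
  have c1 := is_derive_continuous (is_derive_expRM (- B) s).
  by apply: (continuousM c1); apply: F_cont; rewrite s0.
(* Variation of constants: [q] is the integral of exp(-B s) F(s) over [t, b1], and P1 = exp(B t) q
   solves the linear equation. *)
pose q t := G1 t - G1 b1.
have dq t : 0 < t <= b1 -> is_derive t 1 q (- (expR (- B * t) * F t)).
  by move=> /HG1[d _]; have := is_deriveB d (is_derive_cst (G1 b1) t 1); rewrite subr0.
have q_le s t : 0 < s -> s <= t -> t <= b1 -> q t <= q s.
  rewrite le_eqVlt => s0 /predU1P[->//|st] tb.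
  have [|c [/andP[sc ct] E]] := @mean_value R q
      (fun x => - (expR (- B * x) * F x)) s t st.
    by move=> x /andP[sx xt]; apply: dq; apply/andP; split; lra.
  have : 0 <= expR (- B * c) * F c.
    by rewrite mulr_ge0 ?expR_ge0// F_ge0//; apply/andP; split; lra.
  by move: E => /= E ?; nra.
have q0 t : 0 < t -> t <= b1 -> 0 <= q t.
  by move=> t0 tb; have := q_le t b1 t0 tb (lexx _); rewrite /q subrr.
have [s /andP[s0 sb]|G2 HG2] := @right_primitive R (fun s => expR (B * s) * q s) eps b1 eb.
  apply: continuousM; first exact: is_derive_continuous (is_derive_expRM B s).
  by apply: is_derive_continuous (dq s _); rewrite s0 ltW.
have [s /andP[s0 sb]|Y HY] := @right_primitive R (fun s => s * F s) eps a epsa.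
  by apply: continuousM; [exact: cvg_id|apply: F_cont; rewrite s0].
pose P t := - G2 t; pose P1 t := expR (B * t) * q t.
have dP t : 0 < t <= eps -> is_derive t 1 P (P1 t).
  by move=> /HG2[d _]; have := is_deriveN d; rewrite opprK.
have P1_ge0 t : 0 < t <= eps -> 0 <= P1 t.
  by move=> /andP[t0 te]; rewrite mulr_ge0 ?expR_ge0// q0//; lra.
have P_le s t : 0 < s -> s <= t -> t <= eps -> P s <= P t.
  rewrite le_eqVlt => s0 /predU1P[->//|st] te.
  have [|c [/andP[sc ct] E]] := @mean_value R P P1 s t st.
    by move=> x /andP[sx xt]; apply: dP; apply/andP; split; lra.
  have : 0 <= P1 c by apply: P1_ge0; apply/andP; split; lra.
  by move: E => /= E ?; nra.
have Y_le s t : 0 < s -> s <= t -> t <= eps -> Y t <= Y s.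
  rewrite le_eqVlt => s0 /predU1P[->//|st] te.
  have [|c [/andP[sc ct] E]] := @mean_value R Y (fun x => - (x * F x)) s t st.
    by move=> x /andP[sx xt]; apply: (HY x _).1; apply/andP; split; lra.
  have : 0 <= c * F c.
    by rewrite mulr_ge0 ?F_ge0//; [lra|apply/andP; split; lra].
  by move: E => /= E ?; nra.
exists P, P1; split=> [t te|C t1 /andP[t10 t1e] CP].
  split; [exact: dP| |exact: P1_ge0].
  have tb : 0 < t <= b1 by case/andP: te => ? ?; apply/andP; split; lra.
  have := is_deriveM (is_derive_expRM B t) (dq t tb).
  move/is_derive_eq; apply; rewrite /P1 /GRing.scale /=.
  have : expR (- B * t) = (expR (B * t))^-1 by rewrite mulNr expRN.
  by move=> ->; have := expR_gt0 (B * t) => ?; field; rewrite gt_eqF.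
pose kap := expR (- B * eps).
have kap0 : 0 < kap := expR_gt0 _.
(* Of the 3, one comes from P eps - P r <= P eps + C and two from the boundary term r q(r). *)
exists (kap^-1 * (3 * (P eps + C))) => t /andP[t0 te].
have [_ ->] := HY t ltac:(by rewrite t0).
(* The lower bound on [P] holds only below t1, and is used at r and r / 2. Lowering t to r can only
   increase the integral, as [Y] is nonincreasing. *)
pose r := Num.min t (t1 / 2).
have rt : r <= t by rewrite ge_min lexx.
have rt1 : r <= t1 / 2 by rewrite ge_min lexx orbT.
have r0 : 0 < r by rewrite lt_min t0 divr_gt0.
apply: (@le_trans _ _ (Y r - Y eps)); first by have := Y_le r t r0 rt te; lra.
rewrite ler_pdivlMl//.
have re : r < eps by lra.
(* Integration by parts as a monotonicity: Z' = (P1 - q) + (exp(-B x) - kap) x F, and both terms are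
   nonnegative on ]0, eps]. *)
pose Z x := P x - x * q x + kap * Y x.
have dZ x : 0 < x <= eps -> is_derive x 1 Z
    (P1 x - (q x + x * (- (expR (- B * x) * F x))) + kap * (- (x * F x))).
  move=> xe; have xb : 0 < x <= b1 by case/andP: xe => x0 xe; apply/andP; split; lra.
  have d1 : is_derive x 1 (fun y => y * q y) (q x + x * (- (expR (- B * x) * F x))).
    have := is_deriveM (is_derive_id x 1) (dq x xb).
    by move/is_derive_eq; apply; rewrite /GRing.scale /=; ring.
  have d2 := is_deriveZ kap (HY x xe).1.
  exact: is_deriveD (is_deriveB (dP x xe) d1) d2.
have Zr : Z r <= Z eps.
  have [|c [/andP[sc ct] E]] := @mean_value R Z (fun x => P1 x -
      (q x + x * (- (expR (- B * x) * F x))) + kap * (- (x * F x))) r eps re.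
    by move=> x /andP[sx xt]; apply: dZ; apply/andP; split; lra.
  have c0 : 0 < c by lra.
  have Fc : 0 <= F c by apply: F_ge0; apply/andP; split; lra.
  have qc : 0 <= q c by apply: q0; lra.
  have h1 : q c <= P1 c.
    rewrite /P1 ler_peMl// -expR0 ler_expR mulr_ge0// ltW//.
  have h2 : kap <= expR (- B * c).
    by rewrite /kap ler_expR !mulNr lerN2 ler_wpM2l// ltW.
  have h3 : kap * (c * F c) <= expR (- B * c) * (c * F c).
    by rewrite ler_wpM2r// mulr_ge0// ltW.
  by move: E => /= E; nra.
have qe : 0 <= q eps by apply: q0 => //; lra.
(* [q] is nonincreasing and P1 >= q, so (r / 2) q(r) is at most the increment of [P] over
   [r / 2, r]. *)
have rq : r * q r <= 2 * (P eps + C).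
  have r2 : r / 2 < r by lra.
  have [|c [/andP[sc ct] E]] := @mean_value R P P1 (r / 2) r r2.
    by move=> x /andP[sx xt]; apply: dP; apply/andP; split; lra.
  have c0 : 0 < c by lra.
  have qr : q r <= q c by apply: q_le; lra.
  have qc : 0 <= q c by apply: q0; lra.
  have h1 : q c <= P1 c by rewrite /P1 ler_peMl// -expR0 ler_expR mulr_ge0// ltW.
  have Pr : P r <= P eps by apply: P_le; lra.
  have Pr2 : - C <= P (r / 2) by apply: CP; apply/andP; split; lra.
  by move: E => /= E; nra.
have Pr : - C <= P r by apply: CP; apply/andP; split; lra.
by move: Zr; rewrite /Z; nra.
Qed.

End primitives.

(** Near 0, monotone convergence along [eps / (n+1), eps] carries the uniform bound to the extended
    integral; on ]eps, a[ the integrand is bounded and the length finite. *)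
Lemma integral_lt_pinfty {R : realType} (z : R -> R) (eps a C b : R) :
  0 < eps -> eps < a ->
  (forall t, 0 < t < a -> {for t, continuous z}) ->
  (forall t, 0 <= t < a -> 0 <= z t) ->
  (forall t, 0 < t <= eps -> \int[lebesgue_measure]_(s in `[t, eps]) z s <= C) ->
  (forall t, eps < t < a -> z t <= b) ->
  (\int[lebesgue_measure]_(t in `[0%R, a[) (z t)%:E < +oo)%E.
Proof.
move=> eps0 epsa cz z0 zC zb.
have mz : measurable_fun `](0 : R), a[ z.
  apply: measurable_realfun.open_continuous_measurable_fun; first exact: itv_open.
  by move=> x; rewrite inE /= in_itv/=; exact: cz.
have /measurable_realfun.measurable_EFinP mzE := mz.
rewrite -(integral_itv_obnd_cbnd mzE).
have U : `](0 : R), a[%classic = `]0, eps]%classic `|` `]eps, a[%classic.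
  apply/seteqP; split=> x /=; rewrite !in_itv/=.
    by move=> /andP[x0 xa]; case: (leP x eps) => xe; [left|right]; rewrite ?x0.
  by move=> [|] /andP[x1 x2]; apply/andP; split; lra.
have m1 : measurable_fun `](0 : R), eps] z.
  by apply: measurable_funS mz => //; rewrite U; exact: subsetUl.
have m2 : measurable_fun `]eps, a[ z.
  by apply: measurable_funS mz => //; rewrite U; exact: subsetUr.
rewrite U ge0_integral_setU//=; first last.
- apply/disj_setPS => x [] /=; rewrite !in_itv/= => /andP[_ xe] /andP[ex _]; lra.
- move=> x Ux; have : `](0 : R), a[%classic x by rewrite U.
  rewrite /= in_itv/= => /andP[x0 xa].
  by rewrite lee_fin z0// ltW.
- by move: mzE; rewrite U.
apply: lte_add_pinfty.
- pose A (n : nat) := `[eps / n.+1%:R, eps]%classic.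
  have bA : \bigcup_n A n = `]0, eps]%classic.
    apply/seteqP; split=> x /=.
      move=> [n _]; rewrite /A /= !in_itv/= => /andP[x1 ->]; rewrite andbT.
      by apply: lt_le_trans x1; rewrite divr_gt0.
    rewrite in_itv/= => /andP[x0 xe].
    exists (Num.truncn (eps / x)) => //; rewrite /A /= in_itv/= xe andbT.
    rewrite ler_pdivrMr// mulrC -ler_pdivrMr// ltW//.
    exact: truncnS_gt.
  have A0 n x : A n x -> 0 < x <= eps.
    by move=> Ax; have : (\bigcup_n A n) x by [exists n]; rewrite bA /= in_itv.
  have iA n : lebesgue_measure.-integrable (A n) (EFin \o z).
    apply: integrable_itv_continuous => t tA; apply: cz.
    have /andP[t0 te] : 0 < t <= eps by apply: (A0 n); rewrite /A /= in_itv.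
    by rewrite t0 (le_lt_trans te).
  have cv : (\int[lebesgue_measure]_(x in A n) (EFin \o z) x)%E @[n --> \oo] -->
      (\int[lebesgue_measure]_(x in \bigcup_n A n) (EFin \o z) x)%E.
    apply: ge0_nondecreasing_set_cvg_integral.
    - move=> n m nm; apply/subsetPset; apply: subset_itvr; rewrite bnd_simp.
      by rewrite ler_pM2l// lef_pV2 ?posrE// ler_nat.
    - by move=> n; exact: measurable_itv.
    - by move=> n; case/integrableP: (iA n).
    - move=> n x /A0/andP[x0 xe]; rewrite lee_fin z0// ltW//=.
      exact: le_lt_trans epsa.
  have : (\int[lebesgue_measure]_(x in `]0%R, eps]) (z x)%:E <= C%:E)%E.
    rewrite -bA -(cvg_lim (@ereal_hausdorff R) cv).
    apply: lime_le; first by apply/cvg_ex; eexists; exact: cv.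
    apply: nearW => n.
    have := zC (eps / n.+1%:R); rewrite /Rintegral => zCn.
    (* The hypothesis bounds only the real part of the integral, which would be 0 for an infinite
       value; integrability on a compact interval excludes that. *)
    have fz : (\int[lebesgue_measure]_(x in A n) (EFin \o z) x)%E \is a fin_num.
      by apply: integrable_fin_num; [exact: measurable_itv|exact: iA].
    rewrite -(fineK fz) lee_fin.
    apply: zCn; rewrite divr_gt0//= ler_pdivrMr//.
    by apply: ler_peMr; [exact: ltW|rewrite ler1n].
  by move=> /le_lt_trans; apply; exact: ltry.
- apply: (@le_lt_trans _ _ (\int[lebesgue_measure]_(x in `]eps, a[) b%:E)%E).
    apply: ge0_le_integral => //.
    + by move=> x; rewrite /= in_itv/= => /andP[x1 x2]; rewrite lee_fin z0//; apply/andP; split; lra.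
    + exact/measurable_realfun.measurable_EFinP.
  rewrite integral_cst//= lebesgue_measure_itv/= lte_fin epsa -EFinB -EFinM.
  exact: ltry.
Unshelve. all: by end_near. Qed.

(** * The three barriers in the strip *)

Section barriers.
Context {R : realType} {N : nat} (Omega : set 'rV[R]_N).
Hypotheses (Omega_open : open Omega) (Omega_bounded : bounded_set Omega).
Variables (sigma : 'rV[R]_N -> R) (g H : 'I_N -> 'rV[R]_N -> R).
Hypothesis sigmaC2 : twice_derivable sigma g H.
Hypothesis sigma_gt0 : forall x, Omega x -> 0 < sigma x.
Hypothesis sigma_boundary : forall x, boundary Omega x -> sigma x = 0.
Variables (L K Q eps : R).
Hypotheses (L_gt0 : 0 < L) (K_gt0 : 0 < K) (Q_ge0 : 0 <= Q) (eps_gt0 : 0 < eps).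
Hypothesis sigma_bounds : forall x, Omega x -> sigma x <= eps ->
  [/\ 1 + L * Q <= \sum_i g i x ^+ 2, \sum_i g i x ^+ 2 <= K &
      `|\sum_i H i x| <= L].

Let closure_case x : closure Omega x -> Omega x \/ boundary Omega x.
Proof.
move=> cx; have [Ox|nO] := pselect (Omega x); first by left.
by right; apply/boundaryP.
Qed.

Let level_interior x c : closure Omega x -> sigma x = c -> 0 < c -> Omega x.
Proof. by move=> /closure_case[//|/sigma_boundary ->] <-; rewrite ltxx. Qed.

Let level_compact c : compact (closure Omega `&` [set x | sigma x = c]).
Proof.
apply: compact_closedI; first exact: closure_compact.
have -> : [set x | sigma x = c] = sigma @^-1` [set t | t = c] by [].
by case: sigmaC2 => cs _; apply: closed_comp; [move=> ? _; exact: cs|exact: closed_eq].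
Qed.

(** A quantitative Hopf lemma. Where u is below the barrier mu (exp(A sigma) - 1), alpha u < alpha
    mu exp(A sigma), while the barrier has Laplacian mu A exp(A sigma) (A S + T), with S = |grad
    sigma|^2 >= 1 and T = Delta sigma >= -L. *)
Lemma linear_lower_bound (alpha : R) (u : 'rV[R]_N -> R) gu Hu : 0 < alpha ->
  twice_derivable_on Omega u gu Hu -> {within closure Omega, continuous u} ->
  (forall x, boundary Omega x -> u x = 0) -> (forall x, Omega x -> 0 < u x) ->
  (forall x, Omega x -> \sum_i Hu i x <= alpha * u x) ->
  exists2 m, 0 < m & forall x, Omega x -> sigma x <= eps -> m * sigma x <= u x.
Proof.
move=> al0 uC uc ubd upos lapu; have L0 := L_gt0; have e0 := eps_gt0.
have [b b0 ub] : exists2 b, 0 < b & forall x,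
    (closure Omega `&` [set x | sigma x = eps]) x -> b <= u x.
  apply: compact_positive_bound; first exact: level_compact.
    by apply: continuous_subspaceW uc => y [].
  by move=> x [cx /= sx]; apply: upos; exact: level_interior sx _.
(* This gives A >= 1 and A S + T >= A - L = alpha + 1. With mu = b / E eps below, the barrier equals
   b - mu < b at sigma = eps. *)
pose A := L + alpha + 1; pose E t := expR (A * t).
have A0 : 0 < A by rewrite /A; lra.
pose mu := b / E eps.
have Ee0 : 0 < E eps := expR_gt0 _.
have mu0 : 0 < mu by rewrite divr_gt0.
have dW (t : R) : is_derive t 1 (fun s => mu * (E s - 1)) (mu * (A * E t)).
  have := is_deriveZ mu (is_deriveB (is_derive_expRM A t) (is_derive_cst (1 : R) t 1)).
  by rewrite subr0.
have dW1 (t : R) : is_derive t 1 (fun s => mu * (A * E s)) (mu * (A * (A * E t))).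
  exact: is_deriveZ (is_deriveZ A (is_derive_expRM A t)).
exists (mu * A); first exact: mulr_gt0.
move=> x Ox sx; have sx0 := sigma_gt0 Ox.
have : mu * (E (sigma x) - 1) <= u x.
  apply: (@strip_comparison R N Omega Omega_open Omega_bounded sigma g H sigmaC2
    sigma_boundary u gu Hu (fun s => mu * (E s - 1)) (fun s => mu * (A * E s))
    (fun s => mu * (A * (A * E s))) 0 eps).
  - exact: uC.
  - exact: uc.
  - exact: lexx.
  - by move=> t _; exact: is_derive_continuous (dW t).
  - by move=> t _; split.
  - move=> y Oy /andP[sy0 sye] uy.
    have [S1 _] := sigma_bounds Oy (ltW sye).
    have LQ0 : 0 <= L * Q by rewrite mulr_ge0// ltW.
    set S := (\sum_i g i y ^+ 2) in S1 *; set T := \sum_i H i y.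
    rewrite ler_norml => /andP[T1 _].
    apply: (le_lt_trans (lapu y Oy)).
    set e := E (sigma y) in uy *.
    have e0' : 0 < e := expR_gt0 _.
    have h1 : alpha * u y < alpha * (mu * e).
      rewrite ltr_pM2l//; apply: (lt_trans uy).
      by rewrite ltr_pM2l// ltrBlDr ltrDl.
    apply: (lt_le_trans h1).
    have h2 : alpha + 1 <= A * S + T.
      have : A * 1 <= A * S by rewrite ler_pM2l//; lra.
      by rewrite /A in A0 *; lra.
    have h3 : alpha <= A * (A * S + T).
      have : 1 * (alpha + 1) <= A * (A * S + T).
        by apply: ler_pM => //; rewrite /A; lra.
      lra.
    have -> : mu * (A * (A * e)) * S + mu * (A * e) * T =
      A * (A * S + T) * (mu * e) by ring.
    by rewrite ler_wpM2r// mulr_ge0// ltW.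
  - move=> y cy sy0; rewrite /E mulr0 expR0 subrr mulr0.
    by case: (closure_case cy) => [/upos/ltW|/ubd ->].
  - move=> y cy sye; apply: (@le_trans _ _ b); last exact: ub.
    have -> : mu * (E eps - 1) = b - mu by rewrite /mu; field; rewrite gt_eqF.
    lra.
  - exact: subset_closure Ox.
  - by rewrite (ltW sx0).
apply: le_trans; rewrite -mulrA ler_pM2l// lerBrDr addrC.
exact: expR_ge1Dx.
Qed.

(** The comparison is made for [- v] and [- M * PP]. Where v > M PP(sigma), also v >= PP(sigma), so
    1 / k(v) <= 1 / k(PP) and the reaction is at most M / k(PP). The Laplacian of M PP(sigma) is at
    most -M / k(PP), as PP' Delta sigma <= L Q / k(PP) and |grad sigma|^2 >= 1 + L Q; strictness
    comes from beta v > 0. *)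
Lemma profile_upper_bound (k PP D : R -> R) (a beta H0 : R)
    (v : 'rV[R]_N -> R) gv Hv : 0 < beta -> 0 <= H0 -> eps < a ->
  (forall s t, 0 <= s -> s <= t -> k s <= k t) -> (forall t, 0 < t -> 0 < k t) ->
  PP 0 = 0 -> {for 0, continuous PP} ->
  (forall s : R, 0 < s < a -> [/\ 0 < PP s, is_derive (s : R) 1 PP (D s),
     is_derive (s : R) 1 D (- (k (PP s))^-1), 0 < D s & D s * k (PP s) <= Q]) ->
  twice_derivable_on Omega v gv Hv -> {within closure Omega, continuous v} ->
  (forall x, boundary Omega x -> v x = 0) -> (forall x, Omega x -> 0 < v x) ->
  (forall x, Omega x -> beta * v x - H0 / k (v x) <= \sum_i Hv i x) ->
  exists2 M, 1 < M & forall x, Omega x -> sigma x <= eps ->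
    v x <= M * PP (sigma x).
Proof.
move=> be0 H00 ea kmono kpos PP0 cPP dPP vC vc vbd vpos lapv.
have L0 := L_gt0; have e0 := eps_gt0.
have [b b0 vb] := compact_bound (closure_compact Omega_bounded) vc.
have ein : 0 < eps < a by rewrite e0.
have [Pe _ _ _ _] := dPP eps ein.
(* The 1 gives M > 1, [H0] dominates the reaction term, and the quotient puts the barrier above [v]
   at sigma = eps. *)
pose M := 1 + H0 + b / PP eps.
have bP0 : 0 < b / PP eps by rewrite divr_gt0.
have M1 : 1 < M by rewrite /M; lra.
have MH : H0 <= M by rewrite /M; lra.
have MP : b <= M * PP eps.
  have -> : M * PP eps = (1 + H0) * PP eps + b by rewrite /M; field; rewrite gt_eqF.
  by rewrite lerDr mulr_ge0// ?(ltW Pe)//; lra.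
exists M => // x Ox sx; have sx0 := sigma_gt0 Ox.
suff : - M * PP (sigma x) <= - v x by lra.
apply: (@strip_comparison R N Omega Omega_open Omega_bounded sigma g H sigmaC2
    sigma_boundary (fun y => - v y) (fun i y => - gv i y) (fun i y => - Hv i y) (fun s => - M * PP s)
    (fun s => - M * D s) (fun s => - M * (- (k (PP s))^-1)) 0 eps).
- exact: twice_derivable_onN vC.
- by move=> y; exact: (cvgN (vc y)).
- exact: lexx.
- move=> t /andP[t0 te]; apply: continuousM; first exact: cst_continuous.
  move: t0; rewrite le_eqVlt => /predU1P[<-//|t0].
  have [|_ d _ _ _] := dPP t; first by rewrite t0 (le_lt_trans te).
  exact: is_derive_continuous d.
- move=> t /andP[t0 te].
  have [|_ d1 d2 _ _] := dPP t; first by rewrite t0 (lt_trans te).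
  by split; [exact: (is_deriveZ (- M) d1)|exact: (is_deriveZ (- M) d2)].
- move=> y Oy /andP[sy0 sye] vy.
  have [S1 _] := sigma_bounds Oy (ltW sye).
  rewrite ler_norml => /andP[_ T1].
  set S := (\sum_i g i y ^+ 2) in S1 *; set T := (\sum_i H i y) in T1 *.
  have [|P0 _ _ D0 DQ] := dPP (sigma y); first by rewrite sy0 (lt_trans sye).
  set P := PP (sigma y) in P0 DQ vy *; set d := D (sigma y) in D0 DQ *.
  have kP := kpos _ P0.
  have vy0 := vpos y Oy.
  have Pv : P <= v y by have : 1 * P < M * P by [rewrite ltr_pM2r]; lra.
  have kv := kpos _ vy0.
  have kk : (k (v y))^-1 <= (k P)^-1.
    by rewrite lef_pV2 ?posrE//; apply: kmono => //; exact: ltW.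
  rewrite sumrN.
  set I := (k P)^-1 in kk *; have I0 : 0 < I by rewrite /I invr_gt0.
  have h1 : H0 / k (v y) <= M * I.
    by apply: ler_pM => //; rewrite invr_ge0 ltW.
  have h2 : - \sum_i Hv i y < M * I.
    by have := lapv y Oy; have : 0 < beta * v y by [rewrite mulr_gt0]; lra.
  apply: (lt_le_trans h2).
  have dI : d <= Q * I by rewrite -ler_pdivrMr ?invrK.
  have h3 : (1 + L * Q) * I <= S * I by rewrite ler_pM2r.
  have h4 : d * T <= L * (Q * I).
    apply: (@le_trans _ _ (d * L)); first by rewrite ler_pM2l.
    by rewrite mulrC ler_pM2l.
  have -> : - M * - I * S + - M * d * T = M * (S * I - d * T) by ring.
  by rewrite ler_pM2l; lra.
- move=> y cy sy0; rewrite PP0 mulr0; case: (closure_case cy) => [/sigma_gt0|/vbd ->].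
    by rewrite sy0 ltxx.
  by rewrite oppr0.
- by move=> y cy sye; have := vb y cy; lra.
- exact: subset_closure Ox.
- by rewrite (ltW sx0).
Qed.

(** Only u >= 0 is known at the levels [dl] and [eps], so the barrier must be nonpositive at both.
    Its value at the fixed level t1 stays below sup u, which bounds - P dl uniformly in [dl]. *)
Lemma weighted_integral_bound (alpha a : R) (F : R -> R) (u : 'rV[R]_N -> R)
    gu Hu : 0 < alpha -> eps < a ->
  (forall t, 0 < t < a -> {for t, continuous F}) ->
  (forall t, 0 < t < a -> 0 <= F t) ->
  twice_derivable_on Omega u gu Hu -> {within closure Omega, continuous u} ->
  (forall x, closure Omega x -> 0 <= u x) ->
  (forall x, Omega x -> sigma x <= eps ->
     \sum_i Hu i x <= alpha * u x - F (sigma x)) ->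
  (exists x, Omega x /\ sigma x < eps) ->
  exists C, forall t, 0 < t <= eps ->
    \int[lebesgue_measure]_(s in `[t, eps]) (s * F s) <= C.
Proof.
move=> al0 ea Fc F0 uC uc u0 lapu [x1 [Ox1 sx1]].
have L0 := L_gt0; have e0 := eps_gt0; have K0 := K_gt0.
(* The choice B = L makes the contribution of [P] equal to P1 (L S + T) - F S, whose first term is
   nonnegative since S >= 1 and T >= -L. *)
have [P [P1 [dP Pint]]] := iterated_primitive (ltW L0) e0 ea Fc F0.
have pos_plus (l s t : R) : 0 < l -> 1 <= s -> - l <= t -> 0 <= l * s + t by nra.
have pos_minus (l s t : R) : 0 < l -> 1 <= s -> t <= l -> 0 <= (l + 1) * s - t by nra.
have one_plus (l s t : R) : 0 < l -> 1 <= s -> - l <= t -> 1 <= (l + 1) * s + t by nra.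
have combine (c d f f' x y z : R) :
    d <= c -> 0 <= x -> f' <= f -> c + 1 <= y -> 0 <= z -> d - f < x - f' + y + z by lra.
have [U U0 uU] := compact_bound (closure_compact Omega_bounded) uc.
pose t1 := sigma x1; have t10 : 0 < t1 := sigma_gt0 Ox1.
pose A := L + 1; pose mu := alpha * U + 1.
have A0 : 0 < A by rewrite /A; lra.
have mu0 : 0 < mu by rewrite /mu addr_gt0// mulr_gt0.
pose c1 := 1 - expR (- A * eps); pose c2 := 1 - expR (- A * t1).
have c20 : 0 < c2.
  by rewrite subr_gt0 -expR0 ltr_expR mulNr oppr_lt0 mulr_gt0.
have c21 : c2 < c1.
  by rewrite ltrD2l ltrN2 ltr_expR !mulNr ltrN2 ltr_pM2l.
have c10 := lt_trans c20 c21.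
(* The fraction of P eps - P dl that the decaying exponential cancels at level t1; it is below 1
   since t1 < eps. *)
pose th := c2 / c1.
have th1 : th < 1 by rewrite ltr_pdivrMr// mul1r.
pose E t := expR (A * t).
pose C := (1 - th)^-1 * (K * (U + mu * E eps) - P t1 + P eps * th).
apply: (Pint (C) t1); first by rewrite t10 ltW.
move=> dl /andP[dl0 dlt].
have dle : dl < eps by apply: lt_trans sx1.
pose Dp := P eps - P dl.
have Dp0 : 0 <= Dp.
  have [|c [/andP[sc ct] Ec]] := @mean_value R P P1 dl eps dle.
    by move=> x /andP[sx xt]; have [|] := dP x => //; apply/andP; split; lra.
  rewrite /Dp Ec; apply: mulr_ge0; last by lra.
  by have [|] := dP c => //; apply/andP; split; lra.
pose La := Dp / (K * c1).
have La0 : 0 <= La by rewrite divr_ge0// mulr_ge0// ltW.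
pose E' t := expR (- A * t).
(* The first term yields -F S / K >= -F; the second adds at least mu = alpha U + 1 to the Laplacian,
   beating alpha u strictly; the third contributes nonnegatively, and its coefficient [La] is fixed
   by W eps = 0. *)
pose W t := K^-1 * (P t - P dl) + mu * (E t - E eps) + La * (E' t - 1).
pose W1 t := K^-1 * P1 t + mu * (A * E t) + La * (- A * E' t).
pose W2 t := K^-1 * (L * P1 t - F t) + mu * (A * (A * E t)) +
  La * (- A * (- A * E' t)).
have dW t : 0 < t <= eps -> is_derive t 1 W (W1 t) /\ is_derive t 1 W1 (W2 t).
  move=> te; have [d1 d2 _] := dP t te; split.
    have a1 := is_deriveZ K^-1 (is_deriveB d1 (is_derive_cst (P dl) t 1)).
    have a2 := is_deriveZ mu (is_deriveB (is_derive_expRM A t) (is_derive_cst (E eps) t 1)).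
    have a3 := is_deriveZ La (is_deriveB (is_derive_expRM (- A) t) (is_derive_cst (1 : R) t 1)).
    by have := is_deriveD (is_deriveD a1 a2) a3; rewrite !subr0.
  have a1 := is_deriveZ K^-1 d2.
  have a2 := is_deriveZ mu (is_deriveZ A (is_derive_expRM A t)).
  have a3 := is_deriveZ La (is_deriveZ (- A) (is_derive_expRM (- A) t)).
  exact: is_deriveD (is_deriveD a1 a2) a3.
have : W t1 <= u x1.
  apply: (@strip_comparison R N Omega Omega_open Omega_bounded sigma g H sigmaC2
    sigma_boundary u gu Hu W W1 W2 dl eps).
  - exact: uC.
  - exact: uc.
  - exact: ltW.
  - move=> t /andP[t0 te]; have [|d _] := dW t; last exact: is_derive_continuous d.
    by rewrite te andbT (lt_le_trans dl0).
  - by move=> t /andP[t0 te]; apply: dW; rewrite (ltW te) (lt_trans dl0).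
  - move=> y Oy /andP[sy0 sye] _.
    have [S1 SK] := sigma_bounds Oy (ltW sye).
    rewrite ler_norml => /andP[T1 T2].
    have LQ0 : 0 <= L * Q by rewrite mulr_ge0// ltW.
    set S := (\sum_i g i y ^+ 2) in S1 SK *; set T := (\sum_i H i y) in T1 T2 *.
    apply: (le_lt_trans (lapu y Oy (ltW sye))).
    set s := sigma y in sy0 sye *.
    have s0 : 0 < s by apply: lt_trans sy0.
    have Fs : 0 <= F s by apply: F0; rewrite s0 (lt_trans sye).
    have [_ _ P1s] : [/\ is_derive (s : R) 1 P (P1 s),
        is_derive (s : R) 1 P1 (L * P1 s - F s) & 0 <= P1 s].
      by apply: dP; rewrite s0 ltW.
    have uy : alpha * u y <= alpha * U.
      by rewrite ler_pM2l//; apply: uU; exact: subset_closure.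
    have e1 : 1 <= E s by rewrite -expR0 ler_expR mulr_ge0// ltW.
    have e'0 : 0 < E' s := expR_gt0 _.
    have S1' : 1 <= S by apply: le_trans S1; rewrite lerDl.
    have -> : W2 s * S + W1 s * T = K^-1 * (P1 s * (L * S + T)) - F s * (S / K)
      + mu * (A * E s * (A * S + T)) + La * (A * E' s * (A * S - T)).
      by rewrite /W2 /W1; field; rewrite gt_eqF.
    have g1 : 0 <= K^-1 * (P1 s * (L * S + T)).
      rewrite mulr_ge0 ?invr_ge0 ?(ltW K0)// mulr_ge0//.
      exact: pos_plus.
    have g2 : F s * (S / K) <= F s.
      by rewrite ler_piMr// ler_pdivrMr// mul1r.
    have g3 : mu <= mu * (A * E s * (A * S + T)).
      rewrite ler_peMr ?(ltW mu0)//.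
      have -> : (1 : R) = 1 * 1 * 1 by rewrite !mulr1.
      apply: ler_pM; rewrite ?mulr1 ?ler01//; last exact: one_plus.
      rewrite -[X in X <= _]mulr1; apply: ler_pM; rewrite ?ler01//.
      by rewrite lerDr ltW.
    have g4 : 0 <= La * (A * E' s * (A * S - T)).
      rewrite mulr_ge0// mulr_ge0//; first by rewrite mulr_ge0// ltW.
      exact: pos_minus.
    exact: combine uy g1 g2 g3 g4.
  - move=> y cy _; apply: le_trans (u0 y cy).
    rewrite /W subrr mulr0 add0r.
    have h1 : E dl <= E eps by rewrite ler_expR ler_pM2l// ltW.
    have h2 : E' dl <= 1 by rewrite -expR0 ler_expR mulNr oppr_le0 mulr_ge0// ltW.
    by rewrite -oppr_ge0 opprD addr_ge0// -mulrN mulr_ge0// ?(ltW mu0)// opprB subr_ge0.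
  - move=> y cy _; apply: le_trans (u0 y cy).
    rewrite /W subrr mulr0 addr0.
    suff -> : K^-1 * (P eps - P dl) + La * (E' eps - 1) = 0 by [].
    have -> : E' eps - 1 = - c1 by rewrite /c1 opprB.
    by rewrite /La -/Dp; field; apply/andP; split; rewrite gt_eqF.
  - exact: subset_closure Ox1.
  - by rewrite -/t1 (ltW dlt) ltW.
have ux : u x1 <= U by apply: uU; exact: subset_closure.
move=> Wu; have {Wu ux} WU : W t1 <= U by apply: le_trans ux.
have : K * W t1 <= K * U by rewrite ler_pM2l.
have -> : K * W t1 = P t1 - P dl + K * (mu * (E t1 - E eps)) - Dp * th.
  rewrite /W /La; have -> : E' t1 - 1 = - c2 by rewrite /c2 opprB.
  by rewrite /th; field; apply/andP; split; rewrite gt_eqF.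
have Et : 0 <= K * (mu * E t1) by rewrite !mulr_ge0 ?expR_ge0// ltW.
move=> h.
have : - P dl * (1 - th) <= K * (U + mu * E eps) - P t1 + P eps * th.
  by move: h; rewrite /Dp; lra.
move=> h'; suff : - P dl <= C by lra.
by rewrite /C ler_pdivlMl ?subr_gt0// mulrC.
Qed.

End barriers.

(** * Nonexistence: the estimates against the divergent integral *)

Unset Implicit Arguments.

Theorem theorem2p1 (R : realType) (N : nat) (N_ge1 : (1 <= N)%N)
    (Omega : set 'rV[R]_N) (Omega_dom : smooth_bounded_domain Omega)
    (alpha beta gamma : R) (alpha_gt0 : 0 < alpha) (beta_gt0 : 0 < beta)
    (gamma_gt0 : 0 < gamma) (gamma_lt1 : gamma < 1)
    (rho : 'rV[R]_N -> R) (rho_holder : holder_on gamma Omega rho)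
    (rho_ge0 : forall x, Omega x -> 0 <= rho x)
    (rho_neq0 : exists x, Omega x /\ rho x <> 0)
    (f g h k : R -> R)
    (f_nl : nonlinearity gamma f) (g_nl : nonlinearity gamma g)
    (h_nl : nonlinearity gamma h) (k_nl : nonlinearity gamma k)
    (g0 : g 0 = 0) (k0 : k 0 = 0)
    (g_gt0 : forall t : R, 0 < t -> 0 < g t)
    (k_gt0 : forall t : R, 0 < t -> 0 < k t)
    (Psi : R -> R) (Psi_inv : inverse_of_Phi k Psi)
    (int_infty : forall m M : R, 0 < m -> m < 1 -> 1 < M ->
       (\int[lebesgue_measure]_(t in `[0%R, Phi_end k[)
          (t * f (m * t) / g (M * Psi t))%:E = +oo)%E) :
  ~ exists u v : 'rV[R]_N -> R,
      classical_solution Omega alpha beta rho f g h k u v.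
Proof.
move=> [u [v [[uC uc] [vC vc] ueq veq bd]]].
have [Oo _ On Ob Os] := Omega_dom.
have [_ f_ge0 f_mono] := f_nl; have [_ _ g_mono] := g_nl.
have [_ h_ge0 h_mono] := h_nl; have [_ _ k_mono] := k_nl.
have k_cont t : 0 < t -> {for t, continuous k}.
  exact: nonlinearity_continuous gamma_gt0 k_nl.
have a0 := Phi_end_gt0 Psi_inv.
set a := Phi_end k in a0 int_infty *.
have [D dPsi] := Psi_profile k_cont k_gt0 k_mono Psi_inv.
pose Q := Num.sqrt (2 * k 1).
have Q0 : 0 <= Q by exact: sqrtr_ge0.
have [s [gs [Hs [L [K [eps [sC2 s_gt0 s_bd [L0 K0 e0 ea] s_bounds]]]]]]] :=
  normalized_defining_function Oo Ob Os Q0 a0.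
have uC' := Ck2_twice_derivable_on uC; have vC' := Ck2_twice_derivable_on vC.
have u_gt0 x : Omega x -> 0 < u x by move=> /ueq[].
have v_gt0 x : Omega x -> 0 < v x by move=> /veq[].
have u_bd x : boundary Omega x -> u x = 0 by move=> /bd[].
have v_bd x : boundary Omega x -> v x = 0 by move=> /bd[].
have u_ge0 x : closure Omega x -> 0 <= u x.
  move=> cx; have [/u_gt0/ltW//|nO] := pselect (Omega x).
  by rewrite u_bd//; apply/boundaryP.
have fg_ge0 x : Omega x -> 0 <= f (u x) / g (v x).
  move=> Ox; rewrite divr_ge0 ?f_ge0//; first exact/ltW/u_gt0.
  exact/ltW/g_gt0/v_gt0.
have lapu x : Omega x ->
    \sum_i partials u [:: i; i] x <= alpha * u x - f (u x) / g (v x).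
  move=> Ox; have [E _] := ueq x Ox; have := rho_ge0 x Ox.
  by rewrite /laplacian in E; lra.
have [m0 m00 um0] : exists2 m, 0 < m &
    forall x, Omega x -> s x <= eps -> m * s x <= u x.
  apply: (linear_lower_bound Oo Ob sC2 s_gt0 s_bd L0 Q0 e0 s_bounds alpha_gt0 uC' uc u_bd u_gt0).
  by move=> x Ox; have := lapu x Ox; have := fg_ge0 x Ox; lra.
(* The divergence hypothesis is available only for m < 1; a smaller slope keeps the lower bound. *)
pose m := Num.min m0 (2^-1).
have m_gt0 : 0 < m by rewrite /m lt_min m00 invr_gt0 ltr0n.
have m_lt1 : m < 1.
  by apply: (@le_lt_trans _ _ 2^-1); [rewrite ge_min lexx orbT|lra].
have um x : Omega x -> s x <= eps -> m * s x <= u x.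
  move=> Ox sx; apply: le_trans (um0 x Ox sx).
  by rewrite ler_pM2r ?s_gt0// ge_min lexx.
have [U U0 uU] := compact_bound (closure_compact Ob) uc.
(* Psi is unconstrained at negative arguments, whereas the barrier must be continuous at 0 from both
   sides. *)
pose PP t := Psi (Num.max 0 t).
have PPE t : 0 <= t -> PP t = Psi t by move=> t0; rewrite /PP max_r.
have Psi00 : Psi 0 = 0 := Psi0 Psi_inv.
have PP0 : PP 0 = 0 by rewrite PPE.
have cPP : {for 0, continuous PP}.
  apply/cvgrPdist_lt => e e_gt0.
  have [d d0 Pd] := Psi_small k_cont k_gt0 Psi_inv e_gt0.
  near=> t; rewrite PP0 sub0r normrN /PP.
  have td : t < d by near: t; exact: lt_nbhsl.
  have ta : t < a by near: t; exact: lt_nbhsl.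
  have /andP[p0 pe] : 0 <= Psi (Num.max 0 t) < e.
    by apply: Pd; rewrite ?le_max ?gt_max ?lexx//= ?d0 ?a0.
  by rewrite ger0_norm.
have dPP t : 0 < t < a -> [/\ 0 < PP t, is_derive t 1 PP (D t),
    is_derive t 1 D (- (k (PP t))^-1), 0 < D t & D t * k (PP t) <= Q].
  move=> ta; have [/andP[P0 _] d1 d2 D0 DQ] := dPsi t ta.
  have t0 : 0 < t by case/andP: ta.
  rewrite PPE ?(ltW t0)//; split=> //; apply: near_eq_is_derive d1.
  by near=> r; rewrite PPE// ltW//; near: r; exact: lt_nbhsr.
have [M M1 vM] : exists2 M, 1 < M &
    forall x, Omega x -> s x <= eps -> v x <= M * PP (s x).
  apply: (profile_upper_bound Oo Ob sC2 s_gt0 s_bd L0 e0 s_bounds beta_gt0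
    (h_ge0 U (ltW U0)) ea k_mono k_gt0 PP0 cPP dPP vC' vc v_bd v_gt0).
  move=> x Ox; have [E _] := veq x Ox.
  have : h (u x) / k (v x) <= h U / k (v x).
    rewrite ler_pM2r ?invr_gt0 ?k_gt0 ?v_gt0//; apply: h_mono.
      exact/ltW/u_gt0.
    by apply: uU; exact: subset_closure.
  by rewrite /laplacian in E; lra.
have M0 : 0 < M by apply: lt_trans M1.
pose F t := f (m * t) / g (M * Psi t).
have Psi_gt0 t : 0 < t < a -> 0 < Psi t by move=> /dPsi[/andP[]].
have F_cont t : 0 < t < a -> {for t, continuous F}.
  move=> ta; have [/andP[P0 _] d1 _ _ _] := dPsi t ta.
  have t0 : 0 < t by case/andP: ta.
  have MP0 : 0 < M * Psi t by rewrite mulr_gt0.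
  apply: continuousM.
    apply: (@continuous_comp _ _ _ (fun t => m * t) f).
      by apply: continuousM; [exact: cst_continuous|exact: cvg_id].
    by apply: nonlinearity_continuous gamma_gt0 f_nl _; rewrite mulr_gt0.
  apply: cvgV; first by rewrite gt_eqF ?g_gt0.
  apply: (@continuous_comp _ _ _ (fun t => M * Psi t) g).
    by apply: continuousM; [exact: cst_continuous|exact: is_derive_continuous d1].
  exact: nonlinearity_continuous gamma_gt0 g_nl _.
have F_ge0 t : 0 < t < a -> 0 <= F t.
  move=> ta; have t0 : 0 < t by case/andP: ta.
  rewrite divr_ge0//; first by rewrite f_ge0// mulr_ge0// ltW.
  by apply/ltW/g_gt0; rewrite mulr_gt0// Psi_gt0.
have near_boundary : exists x, Omega x /\ s x < eps.
  have [x bx] := boundary_nonempty Oo Ob (Ordinal N_ge1) On.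
  have [cx _] := (boundaryP Oo x).1 bx; have [cs _] := sC2.
  have : nbhs x [set y | s y < eps].
    by apply: (cs x [set t | t < eps]); rewrite s_bd//; exact: lt_nbhsl.
  by move=> /cx[y [Oy sy]]; exists y.
have [C HC] : exists C, forall t, 0 < t <= eps ->
    \int[lebesgue_measure]_(r in `[t, eps]) (r * F r) <= C.
  apply: (weighted_integral_bound Oo Ob sC2 s_gt0 s_bd L0 K0 Q0 e0 s_bounds
    alpha_gt0 ea F_cont F_ge0 uC' uc u_ge0 _ near_boundary).
  (* Monotonicity enters here: f(m sigma) <= f(u) and g(v) <= g(M Psi(sigma)), hence F(sigma) <=
     f(u) / g(v). *)
  move=> x Ox sx; apply: le_trans (lapu x Ox) _; rewrite lerD2l lerN2 /F.
  have sx0 := s_gt0 x Ox.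
  have sa : 0 < s x < a by rewrite sx0 (le_lt_trans sx).
  have gv0 := g_gt0 _ (v_gt0 x Ox).
  have vx := vM x Ox sx; rewrite PPE ?(ltW sx0)// in vx.
  apply: ler_pM; rewrite ?invr_ge0.
  - by rewrite f_ge0// mulr_ge0// ltW.
  - by apply/ltW/g_gt0; rewrite mulr_gt0// Psi_gt0.
  - by apply: f_mono; [rewrite mulr_ge0// ltW|exact: um].
  - rewrite lef_pV2 ?posrE//; last by rewrite g_gt0// mulr_gt0// Psi_gt0.
    by apply: g_mono => //; exact/ltW/v_gt0.
have := int_infty m M m_gt0 m_lt1 M1.
have Pe0 : 0 < Psi eps by rewrite Psi_gt0// e0.
suff : (\int[lebesgue_measure]_(t in `[0%R, a[) (t * F t)%:E < +oo)%E.
  rewrite (_ : (fun t : R => (t * F t)%:E) =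
    (fun t : R => (t * f (m * t) / g (M * Psi t))%:E)).
    by move=> + E; rewrite E ltxx.
  by apply/funext => t; rewrite /F mulrA.
have Psi_mono t : eps <= t -> t < a -> Psi eps <= Psi t.
  rewrite le_eqVlt => /predU1P[->//|et] ta.
  have [|c [/andP[ec ct] E]] := @mean_value R Psi D eps t et.
    move=> x /andP[ex xt]; have [|_ d _ _ _] := dPsi x; last exact: d.
    by rewrite (lt_le_trans e0 ex) (le_lt_trans xt ta).
  have [|_ _ _ Dc _] := dPsi c.
    by rewrite (lt_trans e0 ec) (lt_trans ct ta).
  by rewrite -subr_ge0 E mulr_ge0// ?subr_ge0; apply: ltW.
(* Away from 0 the integrand is bounded by monotonicity of f, g and Psi, so divergence could come
   only from the end t = 0, where [HC] excludes it. *)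
apply: (@integral_lt_pinfty R (fun t => t * F t) eps a C
  (a * (f (m * a) / g (M * Psi eps)))) => //.
- move=> t ta; apply: continuousM; [exact: cvg_id|exact: F_cont].
- move=> t /andP[t0 ta]; move: t0; rewrite le_eqVlt => /predU1P[<-|t0].
    by rewrite mul0r.
  by rewrite mulr_ge0 ?F_ge0 ?t0// ltW.
- move=> t /andP[et ta]; have t0 : 0 < t by apply: lt_trans et.
  have gM0 : 0 < g (M * Psi eps) by rewrite g_gt0// mulr_gt0.
  have PP' : Psi eps <= Psi t by apply: Psi_mono => //; exact: ltW.
  apply: ler_pM; [exact: ltW|by apply: F_ge0; rewrite t0|exact: ltW|].
  apply: ler_pM; rewrite ?invr_ge0.
  + by rewrite f_ge0// mulr_ge0// ltW.
  + by apply/ltW/g_gt0; rewrite mulr_gt0// Psi_gt0// t0.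
  + apply: f_mono; first by rewrite mulr_ge0// ltW.
    by rewrite ler_pM2l// ltW.
  + rewrite lef_pV2 ?posrE//; last by rewrite g_gt0// mulr_gt0// Psi_gt0// t0.
    apply: g_mono; first by rewrite mulr_ge0// ltW.
    by rewrite ler_pM2l.
Unshelve. all: by end_near. Qed.
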